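(* $\mathrm{Aut}(\mathcal{E})=\mathrm{Inn}(\mathcal{E})\rtimes\langle\Psi_T\rangle\cong\mathcal{E}\rtimes\mathbb{Z}/2\mathbb{Z}$.
   Context: Identify $\mathbb{T}^1=\mathbb{R}/\mathbb{Z}$ with $[0,1)$. An interval exchange transformation is a bijection $f:\mathbb{T}^1\to\mathbb{T}^1$ for which there is a partition of $[0,1)$ into finitely many half-open intervals $[a,b)$ on each of which $f$ is a translation $x\mapsto x+c\pmod 1$; such maps are right-continuous. $\mathcal{E}$ is the group of all interval exchange transformations under composition; $\mathrm{Inn}(\mathcal{E})$ is its group of inner automorphisms. Let $T:\mathbb{T}^1\to\mathbb{T}^1$, $T(x)=-x$. For $f\in\mathcal{E}$, $T^{-1}fT$ is an invertible piecewise translation which is left-continuous; $\Psi_T(f)\in\mathcal{E}$ is defined as the right-continuous interval exchange corresponding to it (obtained by replacing the half-open pieces $(a,b]$ by $[a,b)$, i.e. the natural isomorphism from left-continuous interval exchanges to $\mathcal{E}$). $\Psi_T$ is an automorphism of $\mathcal{E}$. *)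

(* Defs.v *)
From Stdlib Require Import Reals Lra List ClassicalEpsilon.
Open Scope R_scope.

(** The circle T^1 = R/Z identified with [0,1). *)
Definition I : Type := {x : R | 0 <= x < 1}.

Lemma frac_part_range (x : R) : 0 <= frac_part x < 1.
Proof. destruct (base_fp x) as [H1 H2]; split; lra. Qed.

Definition toI (x : R) : I := exist _ (frac_part x) (frac_part_range x).

Definition is_IET (f : I -> I) : Prop :=
  (forall x y : I, f x = f y -> x = y) /\
  (forall y : I, exists x : I, f x = y) /\
  exists (n : nat) (a c : nat -> R),
    a 0%nat = 0 /\ a n = 1 /\
    (forall i, (i < n)%nat -> a i < a (S i)) /\
    (forall (x : I) i, (i < n)%nat -> a i <= proj1_sig x < a (S i) ->
        proj1_sig (f x) = frac_part (proj1_sig x + c i)).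

Definition compI (f g : I -> I) : I -> I := fun x => f (g x).

(** phi is a group automorphism of E (only its values on E matter). *)
Definition is_aut (phi : (I -> I) -> (I -> I)) : Prop :=
  (forall f, is_IET f -> is_IET (phi f)) /\
  (forall f g, is_IET f -> is_IET g -> phi (compI f g) = compI (phi f) (phi g)) /\
  (forall f g, is_IET f -> is_IET g -> phi f = phi g -> f = g) /\
  (forall h, is_IET h -> exists f, is_IET f /\ phi f = h).

Definition is_inner (phi : (I -> I) -> (I -> I)) : Prop :=
  exists g, is_IET g /\ forall f, is_IET f -> compI (phi f) g = compI g f.

Definition T (x : I) : I := toI (- proj1_sig x).

Definition cofinite_eq (f g : I -> I) : Prop :=
  exists l : list I, forall x, ~ In x l -> f x = g x.

Definition idI : I -> I := fun x => x.

(** Psi_T(f): the (unique) right-continuous interval exchange corresponding to the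
    left-continuous piecewise translation T^{-1} f T, i.e. the interval exchange
    agreeing with T^{-1} f T off finitely many points (the endpoints of pieces). *)
Definition Psi_T (f : I -> I) : I -> I :=
  epsilon (inhabits idI)
    (fun h => is_IET h /\ cofinite_eq h (compI T (compI f T))).

(* Main.v *)
(** An automorphism [phi] is reconstructed from its effect on involutions.  Inside
    the centraliser of an involution [f], the involutions commuting with all their
    conjugates are exactly the restrictions of [f] to [f]-invariant sets; hence
    "f and g have disjoint supports" is a group-theoretic property, and [phi] induces
    an automorphism [F] of the Boolean algebra of finite unions of intervals [[a,b)],
    whose ultrafilters are the right germs and the left germs of points.  Either [F]
    sends some right germ to a right germ, or this holds after composing [phi] with
    [Psi_T].  In the first case transitivity of the group shows that [F] comes from a
    bijection [g] of the circle with [phi f = g f g^-1].  A Baire category argument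
    makes [g^-1] increasing on some interval, uniqueness of the invariant measure
    makes [g] a translation there, and transitivity again makes [g] an interval
    exchange. *)

From Stdlib Require Import Reals Lra Lia List Classical ClassicalEpsilon FunctionalExtensionality ProofIrrelevance.
From Coquelicot Require Import Coquelicot.
Require Import Defs.
Open Scope R_scope.

(** An abstract automorphism sees no points, so supports must first be expressed through commutation
    alone. Elements of order 3 serve there as test conjugators: the contradiction comes from telling
    [k] from its inverse, which an involution cannot do. Interval exchanges act transitively on
    right germs and never turn a right germ into a left one; [Psi_T] swaps the two kinds, which is
    the source of the factor of order 2. Transitivity is also why a single germ decides the case.
    The obstacle is that [g] comes without any continuity: it is only known that [g] and its inverse
    preserve finite unions of half-open intervals and that conjugation by [g] preserves the group.
    Piecewise affine bijections have the first property, so monotonicity on an interval is not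
    enough; transporting the invariant measure removes the slope. Throughout, finite partitions are
    replaced by conditions on one-sided germs, which pass through composition and gluing without any
    handling of breakpoints. *)

Definition val (x : I) : R := proj1_sig x.
Coercion val : I >-> R.

Lemma val_range (x : I) : 0 <= x < 1.
Proof. exact (proj2_sig x). Qed.

Ltac note_range x :=
  lazymatch goal with
  | _ : 0 <= val x < 1 |- _ => fail
  | _ => pose proof (val_range x)
  end.

Ltac ilra :=
  repeat match goal with
  | |- context [val ?x] => note_range x
  | _ : context [val ?x] |- _ => note_range x
  end; lra.

Lemma val_inj (x y : I) : val x = val y -> x = y.
Proof.
  destruct x as [x hx], y as [y hy]; simpl; intros ->.
  f_equal; apply proof_irrelevance.
Qed.

Lemma val_neq (x y : I) : x <> y -> val x < val y \/ val y < val x.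
Proof.
  intros ne; destruct (Rtotal_order x y) as [|[e|]]; auto.
  destruct ne; apply val_inj, e.
Qed.

Lemma frac_part_eq (k : Z) (r w : R) : r = IZR k + w -> 0 <= w < 1 -> frac_part r = w.
Proof.
  intros -> hw; unfold frac_part.
  replace (Int_part (IZR k + w)) with k; [lra|].
  apply Int_part_spec; lra.
Qed.

Lemma frac_part_split (r : R) : exists k : Z, r = IZR k + frac_part r.
Proof. exists (Int_part r); unfold frac_part; lra. Qed.

Lemma val_toI (r : R) : 0 <= r < 1 -> val (toI r) = r.
Proof. intros hr; apply (frac_part_eq 0); [lra | exact hr]. Qed.

Lemma toI_val (x : I) : toI x = x.
Proof. apply val_inj, val_toI, val_range. Qed.

Lemma toI_shift (k : Z) (r s : R) : r = s + IZR k -> toI r = toI s.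
Proof.
  intros ->; apply val_inj; change (frac_part (s + IZR k) = frac_part s).
  destruct (frac_part_split s) as [m e].
  apply (frac_part_eq (k + m)); [rewrite plus_IZR; lra | apply frac_part_range].
Qed.

Lemma Rmin_pos (a b : R) : 0 < a -> 0 < b -> exists e, 0 < e /\ e <= a /\ e <= b.
Proof.
  intros; exists (Rmin a b); split; [now apply Rmin_glb_lt|].
  split; [apply Rmin_l | apply Rmin_r].
Qed.

(** * Locally constant sets and local translations *)

(** Finite unions of intervals [a,b), encoded by germs. Left germs are indexed by t in (0,1]: on the
    circle, the left germ of 0 is the one at 1. *)
Definition elementary (B : I -> Prop) : Prop :=
  (forall x : I, exists e, 0 < e /\ forall y : I, x <= y < x + e -> (B y <-> B x)) /\
  (forall t, 0 < t <= 1 -> exists e, 0 < e /\ forall y z : I,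
     t - e <= y < t -> t - e <= z < t -> (B y <-> B z)).

(** The equations hold in R, not modulo 1: a piece that wraps around is cut at the wrap. On the left
    of t the constant is free, since [f] may jump at t. *)
Definition local_translation (f : I -> I) : Prop :=
  (forall x : I, exists e, 0 < e /\
     forall y : I, x <= y < x + e -> val (f y) = f x + (y - x)) /\
  (forall t, 0 < t <= 1 -> exists e c, 0 < e /\
     forall y : I, t - e <= y < t -> val (f y) = y + c).

(* Real induction, in the role of compactness of [0,1]. *)
Lemma interval_chain (P : R -> R -> Prop) :
  (forall u v w, 0 <= u < v -> v < w <= 1 -> P u v -> P v w -> P u w) ->
  (forall x, 0 <= x < 1 -> exists e, 0 < e /\ forall v, x < v < x + e -> v <= 1 -> P x v) ->
  (forall x, 0 < x <= 1 -> exists e, 0 < e /\ forall u, x - e < u < x -> 0 <= u -> P u x) ->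
  P 0 1.
Proof.
  intros tr hr hl.
  destruct (completeness (fun v => 0 < v <= 1 /\ P 0 v)) as [s [ub lub]].
  - exists 1; intros v [hv _]; lra.
  - destruct (hr 0) as [e [he H]]; [lra|].
    destruct (Rmin_pos (e / 2) 1) as [d [hd [h1 h2]]]; [lra|lra|].
    exists d; split; [lra|]; apply H; lra.
  - assert (s1 : s <= 1) by (apply lub; intros v [hv _]; lra).
    assert (s0 : 0 < s).
    { destruct (hr 0) as [e [he H]]; [lra|].
      destruct (Rmin_pos (e / 2) 1) as [d [hd [h1 h2]]]; [lra|lra|].
      apply Rlt_le_trans with d; [lra|]; apply ub; split; [lra|]; apply H; lra. }
    assert (Ps : P 0 s).
    { destruct (hl s) as [e [he H]]; [lra|].
      assert (ex : exists v, (0 < v <= 1 /\ P 0 v) /\ s - e < v).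
      { apply NNPP; intros no.
        assert (s <= s - e); [|lra].
        apply lub; intros v hv.
        destruct (Rle_or_lt v (s - e)) as [|lt]; [assumption|].
        destruct no; exists v; auto. }
      destruct ex as [v [[hv Pv] lv]].
      assert (vs : v <= s) by (apply ub; auto).
      destruct (Req_dec v s) as [->|ne]; [assumption|].
      apply (tr 0 v s); try lra; auto; apply H; lra. }
    destruct (Req_dec s 1) as [->|ne]; [assumption|].
    destruct (hr s) as [e [he H]]; [lra|].
    destruct (Rmin_pos (e / 2) (1 - s)) as [d [hd [h1 h2]]]; [lra|lra|].
    assert (s + d <= s); [|lra].
    apply ub; split; [lra|].
    apply (tr 0 s (s + d)); try lra; auto; apply H; lra.
Qed.

Lemma elementary_chain (B : I -> Prop) (P : R -> R -> Prop) : elementary B ->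
  (forall u v w, 0 <= u < v -> v < w <= 1 -> P u v -> P v w -> P u w) ->
  (forall u v, 0 <= u < v -> v <= 1 ->
     (forall y z : I, u <= y < v -> u <= z < v -> (B y <-> B z)) -> P u v) ->
  P 0 1.
Proof.
  intros [hr hl] tr base; apply interval_chain; [exact tr| |].
  - intros x hx; destruct (hr (toI x)) as [e [he H]]; rewrite val_toI in H by lra.
    exists e; split; [assumption|]; intros v hv v1; apply base; try lra.
    intros y z hy hz; rewrite (H y), (H z) by lra; tauto.
  - intros x hx; destruct (hl x hx) as [e [he H]].
    exists e; split; [assumption|]; intros u hu u0; apply base; try lra.
    intros y z hy hz; apply H; lra.
Qed.

Lemma translation_chain (f : I -> I) (P : R -> R -> Prop) : local_translation f ->
  (forall u v w, 0 <= u < v -> v < w <= 1 -> P u v -> P v w -> P u w) ->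
  (forall u v c, 0 <= u < v -> v <= 1 ->
     (forall y : I, u <= y < v -> val (f y) = y + c) -> P u v) ->
  P 0 1.
Proof.
  intros [hr hl] tr base; apply interval_chain; [exact tr| |].
  - intros x hx; destruct (hr (toI x)) as [e [he H]]; rewrite val_toI in H by lra.
    exists e; split; [assumption|]; intros v hv v1.
    apply (base x v (f (toI x) - x)); try lra.
    intros y hy; rewrite (H y) by lra; lra.
  - intros x hx; destruct (hl x hx) as [e [c [he H]]].
    exists e; split; [assumption|]; intros u hu u0; apply (base u x c); try lra.
    intros y hy; apply H; lra.
Qed.

(** If v + c exceeded 1, the image of v - d would already reach 1, for d at most the excess. *)
Lemma translation_range (f : I -> I) (u v c : R) : 0 <= u < v -> v <= 1 ->
  (forall y : I, u <= y < v -> val (f y) = y + c) -> 0 <= u + c /\ v + c <= 1.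
Proof.
  intros hu hv H; split.
  - generalize (H (toI u)); rewrite val_toI by lra.
    intros e; rewrite <- e by lra; apply val_range.
  - destruct (Rle_or_lt (v + c) 1) as [|lt]; [assumption|].
    destruct (Rmin_pos (v - u) (v + c - 1)) as [d [hd [h1 h2]]]; [lra|lra|].
    generalize (H (toI (v - d))); rewrite val_toI by lra.
    intros e; assert (e' := e ltac:(lra)); ilra.
Qed.

(** The bounds make t + c an admissible base point of a left germ again, which is what composition
    needs: images approach t + c from below. *)
Lemma left_germ (f : I -> I) (t : R) : local_translation f -> 0 < t <= 1 ->
  exists e c, 0 < e <= t /\ 0 < t + c <= 1 /\
    forall y : I, t - e <= y < t -> val (f y) = y + c.
Proof.
  intros [_ hl] ht; destruct (hl t ht) as [e [c [he H]]].
  destruct (Rmin_pos e t) as [d [hd [h1 h2]]]; [lra|lra|].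
  exists d, c; split; [lra|].
  assert (H' : forall y : I, t - d <= y < t -> val (f y) = y + c)
    by (intros; apply H; lra).
  destruct (translation_range f (t - d) t c) as [r1 r2]; [lra|lra|assumption|].
  split; [lra|assumption].
Qed.

Lemma local_translation_comp (f g : I -> I) :
  local_translation f -> local_translation g -> local_translation (compI f g).
Proof.
  intros Lf Lg; split.
  - intros x; destruct (proj1 Lg x) as [e [he H]].
    destruct (proj1 Lf (g x)) as [e' [he' H']].
    destruct (Rmin_pos e e' he he') as [d [hd [h1 h2]]].
    exists d; split; [assumption|]; intros y hy; unfold compI.
    assert (k := H y ltac:(lra)).
    rewrite (H' (g y)) by lra; lra.
  - intros t ht; destruct (left_germ g t Lg ht) as [e [c [he [hc H]]]].
    destruct (left_germ f (t + c) Lf hc) as [e' [c' [he' [_ H']]]].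
    destruct (Rmin_pos e e') as [d [hd [h1 h2]]]; try lra.
    exists d, (c + c'); split; [assumption|]; intros y hy; unfold compI.
    assert (k := H y ltac:(lra)).
    rewrite (H' (g y)) by lra; lra.
Qed.

Lemma local_translation_id : local_translation idI.
Proof.
  split; intros x; [exists 1 | intros _; exists 1, 0]; (split; [lra|]);
    intros y _; unfold idI; lra.
Qed.

Lemma elementary_preim (f : I -> I) (B : I -> Prop) :
  local_translation f -> elementary B -> elementary (fun x => B (f x)).
Proof.
  intros Lf [hr hl]; split.
  - intros x; destruct (proj1 Lf x) as [e [he H]].
    destruct (hr (f x)) as [e' [he' H']].
    destruct (Rmin_pos e e' he he') as [d [hd [h1 h2]]].
    exists d; split; [assumption|]; intros y hy.
    assert (k := H y ltac:(lra)); apply H'; lra.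
  - intros t ht; destruct (left_germ f t Lf ht) as [e [c [he [hc H]]]].
    destruct (hl (t + c) hc) as [e' [he' H']].
    destruct (Rmin_pos e e') as [d [hd [h1 h2]]]; try lra.
    exists d; split; [assumption|]; intros y z hy hz.
    assert (k := H y ltac:(lra)); assert (k' := H z ltac:(lra)); apply H'; lra.
Qed.

Lemma elementary_not (B : I -> Prop) : elementary B -> elementary (fun x => ~ B x).
Proof.
  intros [hr hl]; split.
  - intros x; destruct (hr x) as [e [he H]]; exists e; split; [assumption|].
    intros y hy; rewrite (H y hy); tauto.
  - intros t ht; destruct (hl t ht) as [e [he H]]; exists e; split; [assumption|].
    intros y z hy hz; rewrite (H y z hy hz); tauto.
Qed.

Lemma elementary_and (B C : I -> Prop) :
  elementary B -> elementary C -> elementary (fun x => B x /\ C x).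
Proof.
  intros [hr hl] [hr' hl']; split.
  - intros x; destruct (hr x) as [e [he H]], (hr' x) as [e' [he' H']].
    destruct (Rmin_pos e e' he he') as [d [hd [h1 h2]]].
    exists d; split; [assumption|]; intros y hy.
    rewrite (H y), (H' y) by lra; tauto.
  - intros t ht; destruct (hl t ht) as [e [he H]], (hl' t ht) as [e' [he' H']].
    destruct (Rmin_pos e e' he he') as [d [hd [h1 h2]]].
    exists d; split; [assumption|]; intros y z hy hz.
    rewrite (H y z), (H' y z) by lra; tauto.
Qed.

Lemma elementary_ext (B C : I -> Prop) :
  (forall x, B x <-> C x) -> elementary B -> elementary C.
Proof.
  intros ext [hr hl]; split.
  - intros x; destruct (hr x) as [e [he H]]; exists e; split; [assumption|].
    intros y hy; rewrite <- !ext; auto.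
  - intros t ht; destruct (hl t ht) as [e [he H]]; exists e; split; [assumption|].
    intros y z hy hz; rewrite <- !ext; auto.
Qed.

Lemma elementary_or (B C : I -> Prop) :
  elementary B -> elementary C -> elementary (fun x => B x \/ C x).
Proof.
  intros hB hC.
  apply (elementary_ext (fun x => ~ (~ B x /\ ~ C x))); [intros; tauto|].
  apply elementary_not, elementary_and; apply elementary_not; assumption.
Qed.

Lemma elementary_interval (a b : R) : elementary (fun x => a <= x < b).
Proof.
  split.
  - intros x; destruct (Rlt_or_le x a); [exists (a - x); split; [lra|]; intros; lra|].
    destruct (Rlt_or_le x b); [exists (b - x) | exists 1]; split; try lra; intros; lra.
  - intros t ht; destruct (Rle_or_lt t a); [exists 1; split; [lra|]; intros; lra|].
    destruct (Rle_or_lt t b); [exists (t - a) | exists (t - b)]; split; try lra;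
      intros; lra.
Qed.

Lemma elementary_all : elementary (fun _ => True).
Proof.
  apply (elementary_ext (fun x : I => 0 <= x < 1)); [|apply elementary_interval].
  intros x; split; [trivial | intros _; apply val_range].
Qed.

Lemma elementary_moved (f : I -> I) :
  local_translation f -> elementary (fun x => f x <> x).
Proof.
  intros [hr hl]; split.
  - intros x; destruct (hr x) as [e [he H]]; exists e; split; [assumption|].
    intros y hy; specialize (H y hy).
    split; intros ne eq; apply ne, val_inj; apply (f_equal val) in eq; lra.
  - intros t ht; destruct (hl t ht) as [e [c [he H]]]; exists e; split; [assumption|].
    intros y z hy hz; apply H in hy, hz.
    split; intros ne eq; apply ne, val_inj; apply (f_equal val) in eq; lra.
Qed.

Definition glue (B : I -> Prop) (f g : I -> I) (x : I) : I :=
  if excluded_middle_informative (B x) then f x else g x.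

Lemma glue_in (B : I -> Prop) f g x : B x -> glue B f g x = f x.
Proof. unfold glue; destruct excluded_middle_informative; tauto. Qed.

Lemma glue_out (B : I -> Prop) f g x : ~ B x -> glue B f g x = g x.
Proof. unfold glue; destruct excluded_middle_informative; tauto. Qed.

Lemma local_translation_glue (B : I -> Prop) (f g : I -> I) : elementary B ->
  local_translation f -> local_translation g -> local_translation (glue B f g).
Proof.
  intros [hr hl] [fr fl] [gr gl]; split.
  - intros x; destruct (hr x) as [e [he H]].
    destruct (fr x) as [e1 [he1 H1]], (gr x) as [e2 [he2 H2]].
    destruct (Rmin_pos e e1) as [d [hd [h1 h2]]]; try lra.
    destruct (Rmin_pos d e2) as [d' [hd' [h1' h2']]]; try lra.
    exists d'; split; [assumption|]; intros y hy.
    destruct (classic (B x)) as [b|b].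
    + rewrite !glue_in; auto; [apply H1; lra|]; apply H; [lra|assumption].
    + rewrite !glue_out; auto; [apply H2; lra|]; rewrite H; [assumption|lra].
  - intros t ht; destruct (hl t ht) as [e [he H]].
    destruct (fl t ht) as [e1 [c1 [he1 H1]]], (gl t ht) as [e2 [c2 [he2 H2]]].
    destruct (Rmin_pos e e1) as [d [hd [h1 h2]]]; try lra.
    destruct (Rmin_pos d e2) as [d' [hd' [h1' h2']]]; try lra.
    destruct (classic (exists z : I, t - d' <= z < t /\ B z)) as [[z [hz b]]|no].
    + exists d', c1; split; [assumption|]; intros y hy.
      rewrite glue_in; [apply H1; lra|]; apply (H y z); auto; lra.
    + exists d', c2; split; [assumption|]; intros y hy.
      rewrite glue_out; [apply H2; lra|]; intros b; apply no; exists y; auto.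
Qed.

(** Taking e at most the distance from [f x] to [g x] separates the images of a whole right
    neighbourhood. With [g] the identity, a moved point has a neighbourhood displaced off itself. *)
Lemma local_translation_near (f g : I -> I) (x : I) : local_translation f ->
  local_translation g -> f x <> g x ->
  exists e, 0 < e /\ forall y z : I, x <= y < x + e -> x <= z < x + e -> f y <> g z.
Proof.
  intros [fr _] [gr _] ne.
  destruct (fr x) as [e1 [he1 H1]], (gr x) as [e2 [he2 H2]].
  destruct (Rmin_pos e1 e2) as [d [hd [h1 h2]]]; try lra.
  assert (ne' : 0 < Rabs (f x - g x)).
  { apply Rabs_pos_lt; intros e; apply ne, val_inj; lra. }
  destruct (Rmin_pos d (Rabs (f x - g x))) as [d' [hd' [h1' h2']]]; try lra.
  exists d'; split; [assumption|]; intros y z hy hz eq.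
  apply (f_equal val) in eq; rewrite (H1 y), (H2 z) in eq by lra.
  revert h2'; unfold Rabs; destruct Rcase_abs; lra.
Qed.

(** * Interval exchanges *)

Lemma IET_local_translation (f : I -> I) : is_IET f -> local_translation f.
Proof.
  intros [_ [_ [n [a [c [a0 [an [lt H]]]]]]]].
  assert (find : forall m t, (m <= n)%nat -> a 0%nat <= t < a m ->
            exists i, (i < n)%nat /\ a i <= t < a (S i)).
  { induction m as [|m IH]; intros t hm ht; [lra|].
    destruct (Rlt_or_le t (a m)); [apply IH; [lia|lra]|].
    exists m; split; [lia|lra]. }
  assert (findl : forall m t, (m <= n)%nat -> a 0%nat < t <= a m ->
            exists i, (i < n)%nat /\ a i < t <= a (S i)).
  { induction m as [|m IH]; intros t hm ht; [lra|].
    destruct (Rle_or_lt t (a m)); [apply IH; [lia|lra]|].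
    exists m; split; [lia|lra]. }
  split.
  - intros x; destruct (find n x) as [i [hi r]]; [lia|ilra|].
    destruct (frac_part_split (x + c i)) as [k e].
    assert (fx : val (f x) = frac_part (x + c i)) by (apply H; assumption).
    destruct (Rmin_pos (a (S i) - x) (1 - f x)) as [d [hd [h1 h2]]]; try ilra.
    exists d; split; [assumption|]; intros y hy.
    transitivity (frac_part (y + c i)); [apply H; [assumption|unfold val in *; lra]|].
    apply (frac_part_eq k); ilra.
  - intros t ht; destruct (findl n t) as [i [hi r]]; [lia|lra|].
    (* Splitting the negative selects the representative of t + c i in (0,1] instead of [0,1): a
       limit from the left may be 1. *)
    destruct (frac_part_split (- (t + c i))) as [k e].
    assert (rg := frac_part_range (- (t + c i))).
    destruct (Rmin_pos (t - a i) (1 - frac_part (- (t + c i)))) as [d [hd [h1 h2]]];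
      try lra.
    exists d, (c i + IZR (k + 1)); split; [assumption|]; intros y hy.
    transitivity (frac_part (y + c i)); [apply H; [assumption|unfold val in *; lra]|].
    apply (frac_part_eq (- (k + 1))); rewrite ?opp_IZR, ?plus_IZR in *; try lra.
Qed.

(** Partitions of [u,v) in list form, so that chaining is concatenation; they become sequences only
    at the end. *)
Inductive translation_partition (f : I -> I) (v : R) : R -> Prop :=
| tp_one u c : u < v -> (forall y : I, u <= y < v -> val (f y) = y + c) ->
    translation_partition f v u
| tp_cons u w c : u < w -> (forall y : I, u <= y < w -> val (f y) = y + c) ->
    translation_partition f v w -> translation_partition f v u.

Lemma translation_partition_cat f u v w : translation_partition f v u ->
  translation_partition f w v -> translation_partition f w u.
Proof.
  intros h hv; induction h; [eapply tp_cons; eauto | eapply tp_cons; eauto].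
Qed.

Lemma translation_partition_seq f v u : translation_partition f v u ->
  exists (n : nat) (a c : nat -> R), a 0%nat = u /\ a n = v /\
    (forall i, (i < n)%nat -> a i < a (S i)) /\
    (forall (x : I) i, (i < n)%nat -> a i <= x < a (S i) -> val (f x) = x + c i).
Proof.
  intros h; induction h as [u c lt H|u w c lt H _ [n [a [b [a0 [an [mono K]]]]]]].
  - exists 1%nat, (fun i => match i with O => u | S _ => v end), (fun _ => c).
    repeat split; auto.
    + intros i hi; replace i with 0%nat by lia; assumption.
    + intros x i hi; replace i with 0%nat by lia; apply H.
  - exists (S n), (fun i => match i with O => u | S j => a j end),
      (fun i => match i with O => c | S j => b j end).
    repeat split; auto.
    + intros [|i] hi; [rewrite a0; assumption | apply mono; lia].
    + intros x [|i] hi hx; [apply H; rewrite a0 in hx; assumption | apply K; [lia|assumption]].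
Qed.

Lemma IET_intro (f : I -> I) : (forall x y, f x = f y -> x = y) ->
  (forall y, exists x, f x = y) -> local_translation f -> is_IET f.
Proof.
  intros inj sur L; split; [exact inj|]; split; [exact sur|].
  assert (tp : translation_partition f 1 0).
  { apply (translation_chain f (fun u v => translation_partition f v u) L).
    - intros u v w _ _; apply translation_partition_cat.
    - intros u v c hu hv H; apply tp_one with c; [lra|assumption]. }
  destruct (translation_partition_seq _ _ _ tp) as [n [a [c [a0 [an [mono K]]]]]].
  exists n, a, c; repeat split; auto.
  intros x i hi hx.
  transitivity (val x + c i); [apply K; assumption|].
  symmetry; apply (frac_part_eq 0); [unfold val; lra|].
  rewrite <- (K x i hi hx); apply val_range.
Qed.

Lemma IET_inj f : is_IET f -> forall x y, f x = f y -> x = y.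
Proof. intros h; apply h. Qed.

Lemma IET_surj f : is_IET f -> forall y, exists x, f x = y.
Proof. intros h; apply h. Qed.

Lemma IET_comp f g : is_IET f -> is_IET g -> is_IET (compI f g).
Proof.
  intros hf hg; apply IET_intro.
  - intros x y e; apply (IET_inj g hg), (IET_inj f hf), e.
  - intros z; destruct (IET_surj f hf z) as [y <-], (IET_surj g hg y) as [x <-].
    exists x; reflexivity.
  - apply local_translation_comp; apply IET_local_translation; assumption.
Qed.

Lemma IET_cancel (f g : I -> I) : local_translation f ->
  (forall x, g (f x) = x) -> (forall x, f (g x) = x) -> is_IET f.
Proof.
  intros L gf fg; apply IET_intro; [| |assumption].
  - intros x y e; rewrite <- (gf x), e; apply gf.
  - intros y; exists (g y); apply fg.
Qed.

Lemma IET_id : is_IET idI.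
Proof. apply (IET_cancel idI idI); auto using local_translation_id. Qed.

Lemma local_translation_inverse (f h : I -> I) : local_translation f ->
  (forall x, h (f x) = x) -> (forall x, f (h x) = x) -> local_translation h.
Proof.
  intros L hf fh; split.
  - intros y; destruct (proj1 L (h y)) as [e [he H]].
    destruct (Rmin_pos e (1 - h y)) as [d [hd [h1 h2]]]; try ilra.
    exists d; split; [assumption|]; intros z hz.
    assert (k : val (toI (h y + (z - y))) = h y + (z - y)) by (apply val_toI; ilra).
    rewrite <- k; f_equal; rewrite <- (hf (toI (h y + (z - y)))); f_equal.
    apply val_inj; rewrite (H (toI (h y + (z - y)))) by lra.
    rewrite k, fh; lra.
  - intros t ht.
    (* The claim is relativised to source intervals [u,v): either no point just left of t comes from
       [u,v), or [h] is a translation there. In this form it chains over the pieces of [f]; over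
       [0,1) the first alternative is absurd. *)
    assert (P : exists e, 0 < e /\
      ((forall z : I, t - e <= z < t -> ~ (0 <= h z < 1)) \/
       exists c, forall z : I, t - e <= z < t -> val (h z) = z + c)).
    { apply (translation_chain f (fun u v => exists e, 0 < e /\
      ((forall z : I, t - e <= z < t -> ~ (u <= h z < v)) \/
       exists c, forall z : I, t - e <= z < t -> val (h z) = z + c)) L).
      - intros u v w hu hv [e1 [he1 [H1|H1]]]; [|intros _; exists e1; auto].
        intros [e2 [he2 [H2|H2]]]; [|exists e2; auto].
        destruct (Rmin_pos e1 e2) as [d [hd [h1 h2]]]; try lra.
        exists d; split; [assumption|]; left; intros z hz r.
        destruct (Rlt_or_le (h z) v); [apply (H1 z)|apply (H2 z)]; lra.
      - intros u v c hu hv H.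
        assert (img : forall z : I, u <= h z < v -> u + c <= z < v + c).
        { intros z r; assert (k := H _ r); rewrite fh in k; lra. }
        destruct (Rle_or_lt t (u + c)) as [le|lt].
        { exists 1; split; [lra|]; left; intros z hz r; apply img in r; lra. }
        destruct (Rlt_or_le (v + c) t) as [lt'|le].
        { exists (t - (v + c)); split; [lra|]; left; intros z hz r; apply img in r; lra. }
        exists (t - (u + c)); split; [lra|]; right; exists (- c); intros z hz.
        destruct (translation_range f u v c hu hv H).
        assert (k : val (toI (z - c)) = z - c) by (apply val_toI; lra).
        replace (z + - c) with (val (toI (z - c))) by lra.
        f_equal; rewrite <- (hf (toI (z - c))); f_equal; apply val_inj.
        rewrite (H (toI (z - c))); lra. }
    destruct P as [e [he [no|[c H]]]]; [|exists e, c; auto].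
    destruct (Rmin_pos e t) as [d [hd [h1 h2]]]; try lra.
    destruct (no (toI (t - d))); [rewrite val_toI; lra | apply val_range].
Qed.

Lemma IET_inverse f : is_IET f ->
  exists h, is_IET h /\ (forall x, h (f x) = x) /\ (forall x, f (h x) = x).
Proof.
  intros hf.
  destruct (choice (fun y x => f x = y) (IET_surj f hf)) as [h fh].
  assert (kf : forall x, h (f x) = x) by (intros x; apply (IET_inj f hf), fh).
  exists h; split; [|auto]; apply (IET_cancel h f); auto.
  apply (local_translation_inverse f); auto using IET_local_translation.
Qed.

(** * Rotations of the circle and of subintervals *)

Definition rotation (c : R) (x : I) : I := toI (x + c).

Lemma rotation_val (c : R) (x : I) (k : Z) :
  0 <= x + c - IZR k < 1 -> val (rotation c x) = x + c - IZR k.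
Proof. intros h; apply (frac_part_eq k); lra. Qed.

Lemma rotation_add c d x : rotation c (rotation d x) = rotation (d + c) x.
Proof.
  unfold rotation; destruct (frac_part_split (x + d)) as [k e].
  apply (toI_shift (- k)); rewrite opp_IZR.
  change (val (toI (x + d))) with (frac_part (x + d)); lra.
Qed.

Lemma rotation_0 x : rotation 0 x = x.
Proof. unfold rotation; rewrite Rplus_0_r; apply toI_val. Qed.

Lemma local_translation_rotation c : local_translation (rotation c).
Proof.
  split.
  - intros x; destruct (frac_part_split (x + c)) as [k e].
    assert (r := frac_part_range (x + c)).
    assert (ex : val (rotation c x) = x + c - IZR k) by (apply rotation_val; lra).
    exists (1 - frac_part (x + c)); split; [lra|]; intros y hy.
    rewrite (rotation_val c y k); lra.
  - intros t ht; destruct (frac_part_split (- (t + c))) as [k e].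
    assert (r := frac_part_range (- (t + c))).
    exists (1 - frac_part (- (t + c))), (c - IZR (- (k + 1))); split; [lra|].
    intros y hy; rewrite (rotation_val c y (- (k + 1)));
      rewrite opp_IZR, plus_IZR; lra.
Qed.

Lemma IET_rotation c : is_IET (rotation c).
Proof.
  apply (IET_cancel _ (rotation (- c)) (local_translation_rotation c));
    intros x; rewrite rotation_add;
    [replace (c + - c) with 0 by lra | replace (- c + c) with 0 by lra];
    apply rotation_0.
Qed.

Lemma rotation_transitive (x y : I) : rotation (y - x) x = y.
Proof.
  unfold rotation; replace (x + (y - x)) with (val y) by lra; apply toI_val.
Qed.

Lemma rotation_small c (x : I) : 0 <= x + c < 1 -> val (rotation c x) = x + c.
Proof. intros h; rewrite (rotation_val c x 0); lra. Qed.

(** The rotation by d of [a,b) viewed as a circle. With d half or a third of the length it has order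
    2 or 3 and moves every point of [a,b). *)
Definition restricted_rotation (a b d : R) : I -> I :=
  glue (fun x => a <= x < b - d) (rotation d)
    (glue (fun x => b - d <= x < b) (rotation (a - b + d)) idI).

Lemma restricted_rotation_val a b d : 0 <= a -> b <= 1 -> 0 < d < b - a ->
  forall x : I,
    (a <= x < b - d -> val (restricted_rotation a b d x) = x + d) /\
    (b - d <= x < b -> val (restricted_rotation a b d x) = x + a - b + d) /\
    (~ a <= x < b -> restricted_rotation a b d x = x).
Proof.
  intros ha hb hd x; unfold restricted_rotation; repeat split; intros hx.
  - rewrite glue_in by assumption; apply rotation_small; lra.
  - rewrite glue_out, glue_in by lra; rewrite rotation_small; lra.
  - rewrite !glue_out by lra; reflexivity.
Qed.

Lemma local_translation_restricted_rotation a b d :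
  local_translation (restricted_rotation a b d).
Proof.
  repeat apply local_translation_glue; auto using elementary_interval,
    local_translation_rotation, local_translation_id.
Qed.

Lemma half_swap a b : 0 <= a < b -> b <= 1 -> exists s, local_translation s /\
  (forall x, s (s x) = x) /\ (forall x : I, s x <> x <-> a <= x < b).
Proof.
  intros ha hb; set (d := (b - a) / 2).
  exists (restricted_rotation a b d).
  assert (V := restricted_rotation_val a b d ltac:(lra) hb ltac:(unfold d; lra)).
  split; [apply local_translation_restricted_rotation|]; split; intros x;
    destruct (V x) as [v1 [v2 v3]].
  - destruct (classic (a <= x < b)) as [r|r]; [|rewrite !v3; auto].
    apply val_inj; destruct (V (restricted_rotation a b d x)) as [w1 [w2 _]].
    destruct (Rlt_or_le x (b - d)).
    + rewrite w2; rewrite v1; unfold d in *; lra.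
    + rewrite w1; rewrite v2; unfold d in *; lra.
  - split; [intros ne; apply NNPP; intros r; auto|].
    intros r e; apply (f_equal val) in e; destruct (Rlt_or_le x (b - d));
      [rewrite v1 in e | rewrite v2 in e]; unfold d in *; lra.
Qed.

Lemma third_cycle a b : 0 <= a < b -> b <= 1 -> exists k, local_translation k /\
  (forall x, k (k (k x)) = x) /\ (forall x : I, k x <> x <-> a <= x < b).
Proof.
  intros ha hb; set (d := (b - a) / 3).
  exists (restricted_rotation a b d).
  assert (V := restricted_rotation_val a b d ltac:(lra) hb ltac:(unfold d; lra)).
  split; [apply local_translation_restricted_rotation|]; split; intros x;
    destruct (V x) as [v1 [v2 v3]].
  - destruct (classic (a <= x < b)) as [r|r]; [|rewrite !v3; auto].
    apply val_inj; destruct (V (restricted_rotation a b d x)) as [w1 [w2 _]].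
    destruct (V (restricted_rotation a b d (restricted_rotation a b d x)))
      as [z1 [z2 _]].
    destruct (Rlt_or_le x (b - d));
      [assert (e := v1 ltac:(lra)) | assert (e := v2 ltac:(lra))];
    (destruct (Rlt_or_le (restricted_rotation a b d x) (b - d));
      [assert (e' := w1 ltac:(unfold d in *; lra))
      | assert (e' := w2 ltac:(unfold d in *; lra))]);
    (destruct (Rlt_or_le (restricted_rotation a b d (restricted_rotation a b d x)) (b - d));
      [assert (e'' := z1 ltac:(unfold d in *; lra))
      | assert (e'' := z2 ltac:(unfold d in *; lra))]); unfold d in *; lra.
  - split; [intros ne; apply NNPP; intros r; auto|].
    intros r e; apply (f_equal val) in e; destruct (Rlt_or_le x (b - d));
      [rewrite v1 in e | rewrite v2 in e]; unfold d in *; lra.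
Qed.

(** * Involutions and disjointness of supports *)

Lemma disjoint_commute (f g : I -> I) : (forall x y, f x = f y -> x = y) ->
  (forall x y, g x = g y -> x = y) -> (forall x, f x = x \/ g x = x) ->
  forall x, f (g x) = g (f x).
Proof.
  intros fi gi D x; destruct (D x) as [e|e]; rewrite e.
  - destruct (D (g x)) as [e'|e']; [assumption|]; apply gi in e'; rewrite e'; exact e.
  - destruct (D (f x)) as [e'|e']; [apply fi in e'; rewrite e'; auto | auto].
Qed.

Definition involution (f : I -> I) : Prop := is_IET f /\ compI f f = idI.

Lemma invol f : involution f -> forall x, f (f x) = x.
Proof. intros [_ e] x; exact (f_equal (fun k => k x) e). Qed.

Lemma involution_intro f : local_translation f -> (forall x, f (f x) = x) -> involution f.
Proof.
  intros L ff; split; [apply (IET_cancel f f); auto|].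
  apply functional_extensionality, ff.
Qed.

Lemma involution_local_translation f : involution f -> local_translation f.
Proof. intros [h _]; apply IET_local_translation, h. Qed.

Lemma involution_inj f : involution f -> forall x y, f x = f y -> x = y.
Proof. intros h; apply IET_inj, h. Qed.

(** Half swaps of the pieces inside [B] have disjoint supports, so they commute and their product is
    an involution. Hence supports of involutions exhaust the Boolean algebra. *)
Lemma involution_moving (B : I -> Prop) : elementary B ->
  exists s, involution s /\ forall x, s x <> x <-> B x.
Proof.
  intros hB.
  cut (exists s, involution s /\ forall x : I, s x <> x <-> (0 <= x < 1) /\ B x).
  { intros [s [hs H]]; exists s; split; [assumption|]; intros x; rewrite H.
    assert (r := val_range x); tauto. }
  apply (elementary_chain B (fun u v => exists s, involution s /\
    forall x : I, s x <> x <-> (u <= x < v) /\ B x) hB).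
  - intros u v w hu hv [s [hs S]] [s' [hs' S']].
    assert (D : forall x, s x = x \/ s' x = x).
    { intros x; destruct (classic (s x = x)) as [|n1]; [auto|].
      destruct (classic (s' x = x)) as [|n2]; [auto|].
      apply S in n1; apply S' in n2; lra. }
    assert (cm := disjoint_commute s s' (involution_inj s hs) (involution_inj s' hs') D).
    exists (compI s s'); split.
    + apply involution_intro.
      * apply local_translation_comp; apply involution_local_translation; assumption.
      * intros x; unfold compI; rewrite <- cm, !invol; auto.
    + intros x; unfold compI; transitivity (s x <> x \/ s' x <> x).
      * destruct (D x) as [e|e]; [rewrite cm|]; rewrite !e; tauto.
      * rewrite S, S'; split; [intros [[]|[]]; split; [lra|auto|lra|auto]|].
        intros [r b]; destruct (Rlt_or_le x v); [left|right]; split; auto; lra.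
  - intros u v hu hv H; destruct (classic (B (toI u))) as [b|b].
    + destruct (half_swap u v hu hv) as [s [L [ss S]]].
      exists s; split; [apply involution_intro; assumption|].
      intros x; rewrite S; split; [|tauto]; intros r; split; [assumption|].
      apply (H (toI u) x); auto; rewrite val_toI; lra.
    + exists idI; split; [apply involution_intro; auto using local_translation_id|].
      intros x; split; [intros n; destruct n; reflexivity|]; intros [r b'].
      destruct b; apply (H (toI u) x); auto; rewrite val_toI; lra.
Qed.

(** * Restrictions of an involution in group-theoretic terms *)

Definition commuting (f g : I -> I) : Prop := compI f g = compI g f.

Lemma commutingE f g : commuting f g <-> forall x, f (g x) = g (f x).
Proof.
  split; [intros e x; exact (f_equal (fun k => k x) e)|].
  intros e; apply functional_extensionality, e.
Qed.

(* For an involution f these are the elements of the largest abelian normal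
   subgroup of exponent 2 of the centraliser of f. *)
Definition subinvolution (f h : I -> I) : Prop :=
  involution h /\ commuting h f /\
  forall k h', is_IET k -> is_IET h' -> commuting k f ->
    compI h' k = compI k h -> commuting h h'.

(** The product of a cycle [k0] of order 3 on a small interval J with its conjugate by [f]. J is
    chosen so that [f] fixes it pointwise or moves it off itself. In the first case the product is
    the square of [k0], nontrivial because the order is 3; in the second the factors have disjoint
    supports. *)
Lemma centralising_cycle f (x : I) d : involution f -> 0 < d -> exists k,
  is_IET k /\ commuting k f /\ (forall y, k (k (k y)) = y) /\ k x <> x /\
  forall y, k y <> y -> x <= y < x + d \/ x <= f y < x + d.
Proof.
  intros hf hd.
  assert (Lf := involution_local_translation f hf).
  assert (ex : exists e, 0 < e <= d /\ ((forall y : I, x <= y < x + e -> f y = y) \/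
     forall y : I, x <= y < x + e -> ~ x <= f y < x + e)).
  { destruct (classic (f x = x)) as [fx|fx].
    - destruct (proj1 Lf x) as [e [he K]].
      destruct (Rmin_pos e d) as [e' [he' [k1 k2]]]; try lra.
      exists e'; split; [lra|]; left; intros y hy; apply val_inj.
      rewrite (K y), fx by lra; lra.
    - destruct (local_translation_near f idI x Lf local_translation_id fx) as [e [he K]].
      destruct (Rmin_pos e d) as [e' [he' [k1 k2]]]; try lra.
      exists e'; split; [lra|]; right; intros y hy hy'.
      apply (K y (f y)); auto; lra. }
  destruct ex as [e1 [he1 fJ]].
  destruct (Rmin_pos e1 (1 - x)) as [e [he [l1 l2]]]; try ilra.
  destruct (third_cycle x (x + e)) as [k0 [Lk0 [k03 K0]]]; try ilra.
  set (J := fun y : I => x <= y < x + e) in *.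
  assert (jx : J x) by (unfold J; lra).
  assert (fJ' : (forall y, J y -> f y = y) \/ (forall y, J y -> ~ J (f y))).
  { unfold J; destruct fJ as [A|A]; [left; intros y hy; apply A; lra|].
    right; intros y hy hfy; apply (A y); lra. }
  assert (k0n : forall y, ~ J y -> k0 y = y).
  { intros y hy; apply NNPP; rewrite K0; auto. }
  assert (k0i : forall y z, k0 y = k0 z -> y = z).
  { intros y z e'; rewrite <- (k03 y), e'; apply k03. }
  assert (k0J : forall y, J y -> J (k0 y)).
  { intros y hy; apply K0; apply K0 in hy; intros e'; apply hy, k0i, e'. }
  set (k1 := fun y => f (k0 (f y))).
  assert (cm : forall y, k0 (k1 y) = k1 (k0 y)).
  { intros y; unfold k1; destruct fJ' as [A|A].
    - assert (Q : forall z, k0 (f z) = f (k0 z)).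
      { intros z; destruct (classic (J z)) as [j|j].
        - rewrite (A z), (A (k0 z)); auto.
        - rewrite (k0n z) by assumption; apply k0n; intros j'.
          apply j; rewrite <- (invol f hf z), (A _ j'); assumption. }
      rewrite <- !Q, !(invol f hf); reflexivity.
    - apply (disjoint_commute k0 (fun z => f (k0 (f z)))); auto.
      + intros z w e'; apply (involution_inj f hf), k0i, (involution_inj f hf), e'.
      + intros z; destruct (classic (J z)) as [j|j]; [right|left; auto].
        rewrite (k0n (f z)) by auto; apply invol, hf. }
  assert (k13 : forall y, k1 (k1 (k1 y)) = y).
  { intros y; unfold k1; rewrite !(invol f hf), k03; apply invol, hf. }
  assert (k3 : forall y, compI k0 k1 (compI k0 k1 (compI k0 k1 y)) = y).
  { intros y; unfold compI; rewrite <- !cm, k13; apply k03. }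
  exists (compI k0 k1); split; [|split; [|split; [|split]]].
  - apply (IET_cancel _ (fun y => compI k0 k1 (compI k0 k1 y))); auto.
    apply local_translation_comp; [assumption|].
    apply (local_translation_comp f (compI k0 f)); [assumption|].
    apply local_translation_comp; assumption.
  - apply commutingE; intros y; unfold compI; rewrite (cm y); unfold k1.
    rewrite !(invol f hf); reflexivity.
  - exact k3.
  - unfold compI, k1; destruct fJ' as [A|A].
    + rewrite (A x), (A (k0 x)) by auto; intros e'.
      apply (proj2 (K0 x) jx); rewrite <- e' at 1; apply k03.
    + rewrite (k0n (f x)), (invol f hf) by auto; apply K0, jx.
  - intros y ne; apply NNPP; intros no; apply ne; unfold compI, k1.
    rewrite (k0n (f y)), (invol f hf); [apply k0n|]; unfold J in *; lra.
Qed.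

(** If [h x] is neither [x] nor [f x], then [h] carries the support of a short cycle [k] near x and
    [f x] off itself; commutation of [h] with its conjugate by [k] would give k x = k^-1 x.
    Conversely, a conjugate under the centraliser still acts at each point as the identity or as
    [f], and such maps commute. *)
Lemma subinvolutionP f h : involution f ->
  (subinvolution f h <->
   involution h /\ commuting h f /\ forall x, h x = x \/ h x = f x).
Proof.
  intros hf; split; intros [hh [cm H]]; (split; [assumption|]); (split; [assumption|]).
  - intros x; apply NNPP; intros no.
    assert (n1 : h x <> x) by tauto.
    assert (n2 : h x <> f x) by tauto.
    assert (Lf := involution_local_translation f hf).
    assert (Lh := involution_local_translation h hh).
    rewrite commutingE in cm.
    destruct (local_translation_near h idI x Lh local_translation_id n1) as [e1 [he1 H1]].
    destruct (local_translation_near h f x Lh Lf n2) as [e2 [he2 H2]].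
    destruct (Rmin_pos e1 e2) as [e [he [l1 l2]]]; try lra.
    destruct (centralising_cycle f x e hf he) as [k [hk [ck [k3 [kx ks]]]]].
    set (U := fun y => x <= val y < x + e \/ x <= val (f y) < x + e) in *.
    assert (kU : forall y, U y -> U (k y)).
    { intros y u; destruct (classic (k y = y)) as [e'|ne]; [rewrite e'; assumption|].
      apply ks; intros e'; apply ne, (IET_inj k hk), e'. }
    assert (Q : forall y : I, x <= y < x + e -> ~ U (h y)).
    { intros y j [j'|j'].
      - apply (H1 y (h y)); auto; lra.
      - apply (H2 y (f (h y))); try lra; rewrite (invol f hf); auto. }
    assert (hU : forall y, U y -> k (h y) = h y).
    { intros y u; apply NNPP; intros ne; apply ks in ne; destruct u as [j|j].
      - apply (Q y j ne).
      - apply (Q (f y) j); unfold U; rewrite cm, (invol f hf); tauto. }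
    assert (ux : U x) by (left; lra).
    (* On U the conjugate k h k^-1 composed with h acts as k^-1 or k,
       depending on the order. *)
    assert (com : commuting h (compI k (compI h (compI k k)))).
    { apply (H k); auto.
      - apply IET_comp; [assumption|]; apply IET_comp; [apply hh|]; apply IET_comp; assumption.
      - apply functional_extensionality; intros y; unfold compI; rewrite k3; reflexivity. }
    rewrite commutingE in com; specialize (com x); unfold compI in com.
    rewrite !(hU x), (hU (k (k x))), !(invol h hh) in com by auto.
    apply kx, (IET_inj k hk), com.
  - intros k h' hk hh' ck cj; apply commutingE.
    rewrite commutingE in cm, ck.
    assert (cj' : forall x, h' (k x) = k (h x)) by (intros x; exact (f_equal (fun q => q x) cj)).
    assert (H' : forall y, h' y = y \/ h' y = f y).
    { intros y; destruct (IET_surj k hk y) as [x <-]; rewrite cj', <- ck.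
      destruct (H x) as [->| ->]; auto. }
    assert (cm' : forall y, h' (f y) = f (h' y)).
    { intros y; destruct (IET_surj k hk y) as [x <-].
      rewrite <- ck, !cj', cm, ck; reflexivity. }
    intros x; destruct (H x) as [e|e], (H' x) as [e'|e'];
      rewrite ?e, ?e', ?cm, ?cm', ?e, ?e'; reflexivity.
Qed.

(** * Disjointness of supports in group-theoretic terms *)

Definition disjoint_moved (f g : I -> I) : Prop := forall x, f x = x \/ g x = x.

(** J is enlarged to the least [f]-invariant set containing it, so that the restriction stays a
    bijection commuting with [f]. *)
Lemma restrict_involution f (J : I -> Prop) : involution f -> elementary J ->
  subinvolution f (glue (fun x => J x \/ J (f x)) f idI).
Proof.
  intros hf hJ; set (U := fun x => J x \/ J (f x)).
  assert (Lf := involution_local_translation f hf).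
  assert (fU : forall x, U (f x) <-> U x).
  { intros x; unfold U; rewrite (invol f hf); tauto. }
  apply subinvolutionP; [assumption|]; split; [apply involution_intro|split].
  - apply local_translation_glue; auto using local_translation_id.
    apply elementary_or; [|apply elementary_preim]; assumption.
  - intros x; destruct (classic (U x)) as [u|u].
    + rewrite (glue_in U f idI x), glue_in by (assumption || (apply fU; assumption)).
      apply invol, hf.
    + rewrite (glue_out U f idI x), glue_out by assumption; reflexivity.
  - apply commutingE; intros x; destruct (classic (U x)) as [u|u].
    + rewrite !glue_in by (assumption || (apply fU; assumption)); reflexivity.
    + rewrite !glue_out by (rewrite ?fU; assumption); reflexivity.
  - intros x; destruct (classic (U x)) as [u|u];
      [rewrite glue_in | rewrite glue_out]; auto.
Qed.

(** The clause on common restrictions excludes cases such as [f] = [g], where everything commutes.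
    Let x be moved by both. If f x = g x, the maps agree near x and share a nontrivial restriction;
    otherwise the restrictions to a small invariant set around x, composed in the two orders, send x
    to g x and to f x. *)
Lemma disjoint_movedP f g : involution f -> involution g ->
  (disjoint_moved f g <-> forall f1 g1, subinvolution f f1 -> subinvolution g g1 ->
     commuting f1 g1 /\ (f1 = g1 -> f1 = idI)).
Proof.
  intros hf hg; split.
  - intros D f1 g1 s1 s2; apply subinvolutionP in s1, s2; try assumption.
    destruct s1 as [h1 [_ H1]], s2 as [h2 [_ H2]].
    assert (D' : forall x, f1 x = x \/ g1 x = x).
    { intros x; destruct (D x) as [e|e]; [left; destruct (H1 x)|right; destruct (H2 x)];
        congruence. }
    split.
    + apply commutingE, disjoint_commute; [apply involution_inj, h1|apply involution_inj, h2|exact D'].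
    + intros <-; apply functional_extensionality; intros x; destruct (D' x); assumption.
  - intros H x; apply NNPP; intros no.
    assert (n1 : f x <> x) by tauto.
    assert (n2 : g x <> x) by tauto.
    assert (Lf := involution_local_translation f hf).
    assert (Lg := involution_local_translation g hg).
    destruct (classic (f x = g x)) as [fg|fg].
    + destruct (proj1 Lf x) as [e1 [he1 H1]], (proj1 Lg x) as [e2 [he2 H2]].
      destruct (Rmin_pos e1 e2) as [e [he [l1 l2]]]; try lra.
      set (J := fun y : I => x <= y < x + e).
      assert (jx : J x) by (unfold J; lra).
      assert (Jfg : forall y, J y -> f y = g y).
      { intros y j; unfold J in j; apply val_inj; rewrite (H1 y), (H2 y), fg by lra; lra. }
      assert (Jfg' : forall y, J (f y) -> f y = g y).
      { intros y j; apply (involution_inj g hg); rewrite <- Jfg by assumption.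
        rewrite !invol by assumption; reflexivity. }
      assert (eq : glue (fun y => J y \/ J (f y)) f idI
                   = glue (fun y => J y \/ J (g y)) g idI).
      { apply functional_extensionality; intros y.
        assert (Q : J (g y) -> J (f y)).
        { intros j; assert (e' := Jfg _ j); rewrite (invol g hg) in e'.
          rewrite <- e', (invol f hf); assumption. }
        destruct (classic (J y \/ J (f y))) as [u|u].
        - assert (e' : f y = g y) by (destruct u; auto).
          rewrite !glue_in; auto; rewrite <- e'; assumption.
        - rewrite !glue_out; tauto. }
      destruct (H _ _ (restrict_involution f J hf (elementary_interval _ _))
                    (restrict_involution g J hg (elementary_interval _ _))) as [_ K].
      apply K in eq; apply (f_equal (fun q => q x)) in eq.
      rewrite glue_in in eq by auto; apply n1, eq.
    + destruct (local_translation_near f idI x Lf local_translation_id n1) as [e1 [he1 H1]].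
      destruct (local_translation_near g idI x Lg local_translation_id n2) as [e2 [he2 H2]].
      destruct (local_translation_near f g x Lf Lg fg) as [e3 [he3 H3]].
      destruct (Rmin_pos e1 e2) as [e' [he' [l1 l2]]]; try lra.
      destruct (Rmin_pos e' e3) as [e [he [l1' l2']]]; try lra.
      set (J := fun y : I => x <= y < x + e).
      assert (jx : x <= x < x + e) by lra.
      destruct (H _ _ (restrict_involution f J hf (elementary_interval _ _))
                    (restrict_involution g J hg (elementary_interval _ _))) as [K _].
      rewrite commutingE in K; specialize (K x).
      rewrite (glue_in _ f idI x), (glue_in _ g idI x) in K by (left; exact jx).
      apply fg; rewrite !glue_out in K; [symmetry; exact K| |]; unfold J; intros [j|j].
      * apply (H1 x (f x)); auto; lra.
      * apply (H3 x (g (f x))); auto; try lra; rewrite invol; auto.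
      * apply (H2 x (g x)); auto; lra.
      * apply (H3 (f (g x)) x); auto; try lra; rewrite invol; auto.
Qed.

(** * The Boolean automorphism induced by an automorphism *)

Lemma aut_IET phi f : is_aut phi -> is_IET f -> is_IET (phi f).
Proof. intros h; apply h. Qed.

Lemma aut_comp phi f g : is_aut phi -> is_IET f -> is_IET g ->
  phi (compI f g) = compI (phi f) (phi g).
Proof. intros h; apply h. Qed.

Lemma aut_inj phi f g : is_aut phi -> is_IET f -> is_IET g -> phi f = phi g -> f = g.
Proof. intros h; apply h. Qed.

Lemma aut_surj phi h : is_aut phi -> is_IET h -> exists f, is_IET f /\ phi f = h.
Proof. intros a; apply a. Qed.

Lemma aut_id phi : is_aut phi -> phi idI = idI.
Proof.
  intros a; apply functional_extensionality; intros x.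
  apply (IET_inj (phi idI)); [apply aut_IET; auto using IET_id|].
  change (compI (phi idI) (phi idI) x = phi idI x).
  rewrite <- aut_comp; auto using IET_id.
Qed.

Lemma aut_commuting phi f g : is_aut phi -> is_IET f -> is_IET g ->
  (commuting (phi f) (phi g) <-> commuting f g).
Proof.
  intros a hf hg; unfold commuting; rewrite <- !aut_comp by assumption; split.
  - apply aut_inj; auto using IET_comp.
  - intros ->; reflexivity.
Qed.

Lemma aut_involution phi f : is_aut phi -> is_IET f ->
  (involution (phi f) <-> involution f).
Proof.
  intros a hf; unfold involution.
  rewrite <- aut_comp, <- (aut_id phi a) at 1 by assumption; split; intros [_ e].
  - split; [assumption|]; apply (aut_inj phi); auto using IET_comp, IET_id.
  - split; [apply aut_IET; assumption|]; rewrite e; reflexivity.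
Qed.

Lemma aut_subinvolution phi f h : is_aut phi -> is_IET f -> is_IET h ->
  (subinvolution (phi f) (phi h) <-> subinvolution f h).
Proof.
  intros a hf hh; unfold subinvolution.
  rewrite aut_involution, aut_commuting by assumption.
  split; intros [h1 [h2 H]]; (split; [assumption|]); (split; [assumption|]).
  - intros k h' hk hh' ck cj; apply (aut_commuting phi); auto.
    apply (H (phi k)); auto using aut_IET; [apply aut_commuting; auto|].
    rewrite <- !aut_comp by assumption; f_equal; assumption.
  - intros k' h'' hk hh'' ck cj.
    destruct (aut_surj phi k' a hk) as [k [hk' <-]].
    destruct (aut_surj phi h'' a hh'') as [h' [hh' <-]].
    apply aut_commuting; auto; apply (H k); auto; [apply (aut_commuting phi); auto|].
    rewrite <- !aut_comp in cj by assumption; apply (aut_inj phi); auto using IET_comp.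
Qed.

Lemma aut_disjoint_moved phi f g : is_aut phi -> involution f -> involution g ->
  (disjoint_moved (phi f) (phi g) <-> disjoint_moved f g).
Proof.
  intros a hf hg; assert (hf' := proj1 hf); assert (hg' := proj1 hg).
  rewrite !disjoint_movedP; try apply aut_involution; auto.
  assert (sub : forall p q, subinvolution p q -> is_IET q) by (intros p q [[]]; auto).
  split; intros H f1 g1 s1 s2; assert (h1 := sub _ _ s1); assert (h2 := sub _ _ s2).
  - destruct (H (phi f1) (phi g1)) as [K1 K2]; try apply aut_subinvolution; auto.
    split; [apply (aut_commuting phi); auto|].
    intros e; apply (aut_inj phi); auto using IET_id.
    rewrite aut_id by assumption; apply K2; f_equal; assumption.
  - destruct (aut_surj phi f1 a h1) as [f0 [hf0 <-]].
    destruct (aut_surj phi g1 a h2) as [g0 [hg0 <-]].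
    rewrite aut_subinvolution in s1, s2 by assumption.
    destruct (H f0 g0) as [K1 K2]; auto.
    split; [apply aut_commuting; auto|].
    intros e; apply aut_inj in e; auto; rewrite K2 by assumption; apply aut_id, a.
Qed.

Lemma aut_involution_surj phi r : is_aut phi -> involution r ->
  exists s, involution s /\ phi s = r.
Proof.
  intros a hr; destruct (aut_surj phi r a (proj1 hr)) as [s [hs <-]].
  exists s; split; [apply (aut_involution phi)|]; auto.
Qed.

(** Inclusion of supports follows from disjointness: whatever is disjoint from [r] is disjoint from
    [s]. The test involution [q] is supported exactly on the complement of the support of [phi r],
    then pulled back through [phi]. *)
Lemma aut_moved_sub phi s r : is_aut phi -> involution s -> involution r ->
  (forall x, s x <> x -> r x <> x) -> forall y, phi s y <> y -> phi r y <> y.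
Proof.
  intros a hs hr sub y ny e.
  assert (hr' : involution (phi r)) by (apply aut_involution; auto; apply hr).
  destruct (involution_moving (fun z => ~ (phi r z <> z))) as [q [hq Q]].
  { apply elementary_not, elementary_moved, involution_local_translation, hr'. }
  destruct (aut_involution_surj phi q a hq) as [p [hp <-]].
  assert (D : disjoint_moved (phi p) (phi r)).
  { intros z; destruct (classic (phi p z = z)) as [|n]; [auto|right].
    apply Q in n; apply NNPP, n. }
  apply aut_disjoint_moved in D; auto.
  assert (D' : disjoint_moved p s).
  { intros z; destruct (D z) as [|n]; [auto|right].
    apply NNPP; intros n'; apply (sub z n' n). }
  apply (aut_disjoint_moved phi) in D'; auto.
  destruct (D' y) as [e'|e']; [|contradiction].
  apply (proj2 (Q y)) in e'; auto.
Qed.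

(* The choice of [s] is immaterial, see [inducedE]. *)
Definition induced (phi : (I -> I) -> I -> I) (B : I -> Prop) (y : I) : Prop :=
  exists s, involution s /\ (forall x, s x <> x <-> B x) /\ phi s y <> y.

Lemma inducedE phi s B y : is_aut phi -> involution s -> (forall x, s x <> x <-> B x) ->
  (induced phi B y <-> phi s y <> y).
Proof.
  intros a hs S; split; [|intros n; exists s; auto].
  intros [r [hr [Q n]]]; revert y n; apply aut_moved_sub; auto.
  intros x n; apply S, Q, n.
Qed.

Lemma induced_elementary phi B : is_aut phi -> elementary B -> elementary (induced phi B).
Proof.
  intros a hB; destruct (involution_moving B hB) as [s [hs S]].
  apply (elementary_ext (fun y => phi s y <> y)).
  - intros y; symmetry; apply inducedE; auto.
  - apply elementary_moved, IET_local_translation, aut_IET; [assumption|apply hs].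
Qed.

Lemma induced_surj phi D : is_aut phi -> elementary D ->
  exists B, elementary B /\ forall y, induced phi B y <-> D y.
Proof.
  intros a hD; destruct (involution_moving D hD) as [r [hr Q]].
  destruct (aut_involution_surj phi r a hr) as [s [hs <-]].
  exists (fun x => s x <> x); split.
  - apply elementary_moved, involution_local_translation, hs.
  - intros y; rewrite <- Q; apply inducedE; auto; intros; tauto.
Qed.

Lemma induced_disjoint phi B C : is_aut phi -> elementary B -> elementary C ->
  ((forall y, ~ (induced phi B y /\ induced phi C y)) <-> (forall x, ~ (B x /\ C x))).
Proof.
  intros a hB hC; destruct (involution_moving B hB) as [s [hs S]].
  destruct (involution_moving C hC) as [r [hr Q]].
  assert (D := aut_disjoint_moved phi s r a hs hr); unfold disjoint_moved in D.
  split; intros H.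
  - intros x; rewrite <- S, <- Q; destruct (proj1 D) with x; try tauto.
    intros y; specialize (H y); rewrite (inducedE phi s), (inducedE phi r) in H; auto.
    tauto.
  - intros y; rewrite (inducedE phi s), (inducedE phi r) by auto.
    destruct (proj2 D) with y; try tauto.
    intros x; specialize (H x); rewrite <- S, <- Q in H; tauto.
Qed.

(** The uncovered part is the image of some [E]; disjointness is reflected, so [E] misses all three
    sets and is empty. Three sets are enough to yield both complements and differences. *)
Lemma induced_cover phi B1 B2 B3 y : is_aut phi ->
  elementary B1 -> elementary B2 -> elementary B3 ->
  (forall x, B1 x \/ B2 x \/ B3 x) ->
  induced phi B1 y \/ induced phi B2 y \/ induced phi B3 y.
Proof.
  intros a h1 h2 h3 cov; apply NNPP; intros no.
  destruct (induced_surj phi (fun z => ~ (induced phi B1 z \/ induced phi B2 z \/ induced phi B3 z)))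
    as [E [hE H]]; auto.
  { apply elementary_not; repeat apply elementary_or; apply induced_elementary; auto. }
  assert (dis : forall B, elementary B -> (forall z, induced phi B z ->
      induced phi B1 z \/ induced phi B2 z \/ induced phi B3 z) -> forall x, ~ (E x /\ B x)).
  { intros B hB sub; apply (induced_disjoint phi); auto.
    intros z [i j]; apply H in i; apply i, sub, j. }
  assert (emp : forall x, ~ (E x /\ E x)).
  { intros x [e _]; destruct (cov x) as [b|[b|b]];
      [apply (dis B1 h1) with x | apply (dis B2 h2) with x | apply (dis B3 h3) with x];
      auto; intros; tauto. }
  rewrite <- (induced_disjoint phi) in emp by auto.
  apply (emp y); rewrite H; auto.
Qed.

Lemma induced_not phi B y : is_aut phi -> elementary B ->
  (induced phi (fun x => ~ B x) y <-> ~ induced phi B y).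
Proof.
  intros a hB; assert (hN := elementary_not B hB); split.
  - intros n i; apply (proj2 (induced_disjoint phi B _ a hB hN)) with y; auto.
    intros x; tauto.
  - intros n; destruct (induced_cover phi B (fun x => ~ B x) B y) as [|[|]]; auto; try tauto.
    intros x; tauto.
Qed.

Lemma induced_mono phi B C y : is_aut phi -> elementary B -> elementary C ->
  (forall x, B x -> C x) -> induced phi B y -> induced phi C y.
Proof.
  intros a hB hC sub i; apply NNPP; rewrite <- induced_not by auto; intros j.
  apply (proj2 (induced_disjoint phi B _ a hB (elementary_not C hC))) with y; auto.
  intros x [b n]; auto.
Qed.

Lemma induced_diff phi B C y : is_aut phi -> elementary B -> elementary C ->
  induced phi B y -> ~ induced phi C y -> induced phi (fun x => B x /\ ~ C x) y.
Proof.
  intros a hB hC i j.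
  destruct (induced_cover phi (fun x => ~ B x) C (fun x => B x /\ ~ C x) y)
    as [k|[k|k]]; auto using elementary_not, elementary_and.
  - intros x; tauto.
  - apply induced_not in k; tauto.
  - contradiction.
Qed.

(** Conjugating [s] by [f] replaces its support B by the preimage of B, and [phi] respects
    conjugation. This equivariance ties the Boolean automorphism to the action of [phi f] on
    points. *)
Lemma induced_preim phi f B y : is_aut phi -> is_IET f -> elementary B ->
  (induced phi (fun x => B (f x)) y <-> induced phi B (phi f y)).
Proof.
  intros a hf hB; destruct (involution_moving B hB) as [s [hs S]].
  destruct (IET_inverse f hf) as [h [hh [hf' fh]]].
  set (r := compI h (compI s f)).
  assert (hr : involution r).
  { apply involution_intro.
    - apply local_translation_comp; [|apply local_translation_comp];
        apply IET_local_translation; auto; apply hs.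
    - intros x; unfold r, compI; rewrite fh, (invol s hs); apply hf'. }
  rewrite (inducedE phi r), (inducedE phi s); auto.
  - assert (e : phi f (phi r y) = phi s (phi f y)).
    { change (compI (phi f) (phi r) y = compI (phi s) (phi f) y).
      rewrite <- !aut_comp; auto; try apply hr; try apply hs.
      replace (compI f r) with (compI s f); [reflexivity|].
      apply functional_extensionality; intros x; unfold r, compI; rewrite fh; reflexivity. }
    rewrite <- e; split; intros n e'; apply n; [|rewrite e'; reflexivity].
    apply (IET_inj (phi f)); auto using aut_IET.
  - intros x; rewrite <- S; unfold r, compI; split; intros n e; apply n;
      [rewrite e; apply hf' | rewrite <- e at 2; rewrite fh; reflexivity].
Qed.

(** * The invariant measure *)

(** Defined on all of R, with value 0 outside [0,1), so that the Riemann integral applies. *)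
Definition indicator (B : I -> Prop) (r : R) : R :=
  if excluded_middle_informative (exists x : I, val x = r /\ B x) then 1 else 0.

Lemma indicator_in B (x : I) : B x -> indicator B x = 1.
Proof.
  intros b; unfold indicator; destruct excluded_middle_informative as [|n]; [reflexivity|].
  destruct n; exists x; auto.
Qed.

Lemma indicator_out B (x : I) : ~ B x -> indicator B x = 0.
Proof.
  intros b; unfold indicator; destruct excluded_middle_informative as [[z [e i]]|n];
    [|reflexivity].
  apply val_inj in e; subst; contradiction.
Qed.

Lemma indicator_iff B C (x y : I) : (B x <-> C y) -> indicator B x = indicator C y.
Proof.
  intros e; destruct (classic (B x)) as [b|b].
  - rewrite !indicator_in; tauto.
  - rewrite !indicator_out; tauto.
Qed.

Lemma indicator_ge0 B r : 0 <= indicator B r.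
Proof. unfold indicator; destruct excluded_middle_informative; lra. Qed.

Lemma RInt_ext_in (f g : R -> R) a b : 0 <= a <= b -> b <= 1 ->
  (forall x : I, a < x < b -> f x = g x) -> RInt f a b = RInt g a b.
Proof.
  intros ha hb H; apply RInt_ext; intros x; rewrite Rmin_left, Rmax_right by lra.
  intros hx; rewrite <- (val_toI x) by lra; apply H; rewrite val_toI; lra.
Qed.

Lemma ex_RInt_indicator B a b : elementary B -> 0 <= a <= b -> b <= 1 ->
  ex_RInt (indicator B) a b.
Proof.
  intros hB ha hb; assert (ex : ex_RInt (indicator B) 0 1).
  { apply (elementary_chain B (ex_RInt (indicator B)) hB).
    - intros u v w _ _; apply ex_RInt_Chasles.
    - intros u v hu hv H; apply (ex_RInt_ext (fun _ => indicator B (toI u))).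
      + intros x; rewrite Rmin_left, Rmax_right by lra; intros hx.
        rewrite <- (val_toI x) by lra; apply indicator_iff, H; rewrite val_toI; lra.
      + apply ex_RInt_const. }
  apply (ex_RInt_Chasles_1 (V := R_CompleteNormedModule) _ a b 1); [lra|].
  apply (ex_RInt_Chasles_2 (V := R_CompleteNormedModule) _ 0 a 1); [lra|assumption].
Qed.

Definition lebesgue (B : I -> Prop) : R := RInt (indicator B) 0 1.

Lemma lebesgue_ext B C : (forall x, B x <-> C x) -> lebesgue B = lebesgue C.
Proof.
  intros e; apply RInt_ext_in; try lra; intros x _; apply indicator_iff, e.
Qed.

Lemma lebesgue_ge0 B : elementary B -> 0 <= lebesgue B.
Proof.
  intros hB; apply RInt_ge_0; [lra|apply ex_RInt_indicator; auto; lra|].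
  intros; apply indicator_ge0.
Qed.

Lemma lebesgue_add B C : elementary B -> elementary C -> (forall x, ~ (B x /\ C x)) ->
  lebesgue (fun x => B x \/ C x) = lebesgue B + lebesgue C.
Proof.
  intros hB hC D; unfold lebesgue.
  transitivity (RInt (fun r => plus (indicator B r) (indicator C r)) 0 1).
  2: { apply (RInt_plus (V := R_CompleteNormedModule)); apply ex_RInt_indicator; auto; lra. }
  apply RInt_ext_in; try lra; intros x _.
  change (plus (indicator B x) (indicator C x)) with (indicator B x + indicator C x).
  specialize (D x); destruct (classic (B x)) as [b|b], (classic (C x)) as [c|c]; try tauto.
  - rewrite (indicator_in _ x), (indicator_in B), (indicator_out C) by tauto; lra.
  - rewrite (indicator_in _ x), (indicator_out B), (indicator_in C) by tauto; lra.
  - rewrite (indicator_out _ x), (indicator_out B), (indicator_out C) by tauto; lra.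
Qed.

Lemma lebesgue_restrict B a b : elementary B -> 0 <= a <= b -> b <= 1 ->
  lebesgue (fun x => B x /\ a <= x < b) = RInt (indicator B) a b.
Proof.
  intros hB ha hb; unfold lebesgue; set (B' := fun x => B x /\ a <= val x < b).
  assert (hB' : elementary B') by (apply elementary_and; auto using elementary_interval).
  assert (E := fun p q hp hq => ex_RInt_indicator B' p q hB' hp hq).
  rewrite <- (RInt_Chasles (V := R_CompleteNormedModule) _ 0 a 1) by (apply E; lra).
  rewrite <- (RInt_Chasles (V := R_CompleteNormedModule) _ a b 1) by (apply E; lra).
  rewrite (RInt_ext_in (indicator B') (fun _ => 0) 0 a); try lra.
  2: { intros x hx; apply indicator_out; unfold B'; lra. }
  rewrite (RInt_ext_in (indicator B') (fun _ => 0) b 1); try lra.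
  2: { intros x hx; apply indicator_out; unfold B'; lra. }
  rewrite (RInt_ext_in (indicator B') (indicator B) a b); try lra.
  2: { intros x hx; apply indicator_iff; unfold B'; split; [tauto|]; split; [assumption|lra]. }
  rewrite !RInt_const; unfold plus, scal; simpl; unfold mult; simpl; lra.
Qed.

Lemma lebesgue_interval a b : 0 <= a <= b -> b <= 1 -> lebesgue (fun x => a <= x < b) = b - a.
Proof.
  intros ha hb; rewrite (lebesgue_ext _ (fun x => True /\ a <= x < b)) by (intros; tauto).
  rewrite lebesgue_restrict; auto using elementary_all.
  rewrite (RInt_ext_in _ (fun _ => 1)); auto.
  - rewrite RInt_const; unfold scal; simpl; unfold mult; simpl; lra.
  - intros x _; apply indicator_in; trivial.
Qed.

(** A change of variable on each piece of [f]; the chained equation follows the part of [B] whose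
    preimages lie in [u,v). *)
Lemma lebesgue_invariant f B : is_IET f -> elementary B ->
  lebesgue (fun x => B (f x)) = lebesgue B.
Proof.
  intros hf hB; destruct (IET_inverse f hf) as [h [hh [kf fk]]].
  assert (Lf := IET_local_translation f hf).
  assert (hBf := elementary_preim f B Lf hB).
  assert (hpart : forall u v, elementary (fun y => B y /\ u <= h y < v)).
  { intros u v; apply elementary_and; [assumption|].
    apply (elementary_preim h (fun x => u <= x < v));
      auto using elementary_interval, IET_local_translation. }
  transitivity (lebesgue (fun y => B y /\ 0 <= h y < 1)).
  2: { apply lebesgue_ext; intros x; assert (r := val_range (h x)); tauto. }
  apply (translation_chain f (fun u v => RInt (indicator (fun x => B (f x))) u v
           = lebesgue (fun y => B y /\ u <= h y < v)) Lf).
  - intros u v w hu hv e1 e2.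
    rewrite <- (RInt_Chasles (V := R_CompleteNormedModule) _ u v w) by (apply ex_RInt_indicator; auto; lra).
    rewrite e1, e2; unfold plus; simpl; rewrite <- lebesgue_add; auto.
    + apply lebesgue_ext; intros x; split; [intros [[]|[]]; split; auto; lra|].
      intros [b r]; destruct (Rlt_or_le (h x) v); [left|right]; split; auto; lra.
    + intros x; lra.
  - intros u v c hu hv H; destruct (translation_range f u v c hu hv H) as [r1 r2].
    transitivity (RInt (indicator B) (u + c) (v + c)).
    + transitivity (RInt (fun x => scal 1 (indicator B (1 * x + c))) u v).
      * apply RInt_ext_in; try lra; intros x hx.
        replace (1 * x + c) with (val (f x)) by (rewrite H; lra).
        unfold scal; simpl; unfold mult; simpl; rewrite Rmult_1_l.
        apply indicator_iff; tauto.
      * rewrite (RInt_comp_lin (V := R_CompleteNormedModule) (indicator B)).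
        -- f_equal; lra.
        -- apply ex_RInt_indicator; auto; lra.
    + rewrite <- lebesgue_restrict by (auto; lra).
      apply lebesgue_ext; intros y; split; intros [b r]; (split; [assumption|]).
      * assert (k : val (toI (y - c)) = y - c) by (apply val_toI; lra).
        assert (e : h y = toI (y - c)).
        { rewrite <- (kf (toI (y - c))); f_equal; apply val_inj; rewrite (H (toI (y - c))); lra. }
        rewrite e; lra.
      * assert (e := H _ r); rewrite fk in e; lra.
Qed.

(** Finite additivity is enough: rotation invariance makes [L] additive, and positivity with total
    mass 1 keeps it in [0,1]. *)
Lemma lebesgue_unique (nu : (I -> Prop) -> R) :
  (forall B C, (forall x, B x <-> C x) -> nu B = nu C) ->
  (forall B, elementary B -> 0 <= nu B) ->
  (forall B C, elementary B -> elementary C -> (forall x, ~ (B x /\ C x)) ->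
     nu (fun x => B x \/ C x) = nu B + nu C) ->
  nu (fun _ => True) = 1 ->
  (forall f B, is_IET f -> elementary B -> nu (fun x => B (f x)) = nu B) ->
  forall a b, 0 <= a <= b -> b <= 1 -> nu (fun x => a <= x < b) = b - a.
Proof.
  intros ext ge0 add tot inv.
  set (L := fun t => nu (fun x : I => 0 <= x < t)).
  assert (split : forall a b, 0 <= a <= b -> b <= 1 ->
            L b = L a + nu (fun x : I => a <= x < b)).
  { intros a b ha hb; unfold L; rewrite <- add; auto using elementary_interval.
    - apply ext; intros x; lra.
    - intros x; lra. }
  assert (shift : forall a b, 0 <= a <= b -> b <= 1 ->
            nu (fun x : I => a <= x < b) = L (b - a)).
  { intros a b ha hb; unfold L.
    rewrite <- (inv (rotation (- a)) (fun x => 0 <= x < b - a));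
      auto using IET_rotation, elementary_interval.
    apply ext; intros x; destruct (Rle_or_lt a x).
    - rewrite rotation_small by ilra; lra.
    - rewrite (rotation_val (- a) x (-1)) by ilra; ilra. }
  assert (Ladd : forall s t, 0 <= s -> 0 <= t -> s + t <= 1 -> L (s + t) = L s + L t).
  { intros s t hs ht h; rewrite (split s (s + t)), shift by lra.
    f_equal; f_equal; lra. }
  assert (L1 : L 1 = 1).
  { rewrite <- tot at 2; apply ext; intros x; assert (r := val_range x); tauto. }
  assert (Lge : forall t, 0 <= L t) by (intros t; apply ge0, elementary_interval).
  assert (Lle : forall t, 0 <= t <= 1 -> L t <= 1).
  { intros t ht; assert (e := Ladd t (1 - t) ltac:(lra) ltac:(lra) ltac:(lra)).
    replace (t + (1 - t)) with 1 in e by lra; assert (p := Lge (1 - t)); lra. }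
  (* L - id is a bounded homomorphism on R/Z, hence zero. *)
  assert (mult : forall t, 0 <= t <= 1 -> forall n : nat, exists w, 0 <= w <= 1 /\
            L w - w = INR n * (L t - t)).
  { intros t ht; induction n as [|n [w [hw e]]].
    - exists 0; split; [lra|]; assert (e := Ladd 0 0 ltac:(lra) ltac:(lra) ltac:(lra)).
      rewrite Rplus_0_r in e; simpl; lra.
    (* [w] represents n t modulo 1; subtracting 1 leaves [L w - w] unchanged because [L 1] = 1. *)
    - rewrite S_INR; destruct (Rle_or_lt (w + t) 1).
      + exists (w + t); split; [lra|]; rewrite Ladd; lra.
      + exists (w + t - 1); split; [lra|].
        assert (e1 := Ladd (1 - t) t ltac:(lra) ltac:(lra) ltac:(lra)).
        assert (e2 := Ladd (1 - t) (w + t - 1) ltac:(lra) ltac:(lra) ltac:(lra)).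
        replace (1 - t + t) with 1 in e1 by lra.
        replace (1 - t + (w + t - 1)) with w in e2 by lra; lra. }
  assert (Lid : forall t, 0 <= t <= 1 -> L t = t).
  { intros t ht; apply NNPP; intros ne.
    assert (p : 0 < Rabs (L t - t)) by (apply Rabs_pos_lt; lra).
    destruct (archimed_cor1 (Rabs (L t - t)) p) as [n [hn n0]].
    destruct (mult t ht n) as [w [hw e]].
    assert (b : Rabs (L w - w) <= 1).
    { assert (b1 := Lge w); assert (b2 := Lle w hw); apply Rabs_le; lra. }
    rewrite e, Rabs_mult, (Rabs_pos_eq (INR n)) in b by apply pos_INR.
    assert (n0' : 0 < INR n) by (apply lt_0_INR, n0).
    apply (Rmult_lt_compat_l (INR n)) in hn; [|assumption].
    rewrite Rinv_r in hn by lra; lra. }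
  intros a b ha hb; rewrite shift, Lid; lra.
Qed.

(** * The normaliser of the group of interval exchanges *)

(* Baire category argument. *)
Lemma increasing_somewhere (h : I -> I) : (forall x y, h x = h y -> x = y) ->
  (forall y : I, exists e, 0 < e /\ forall z : I, y <= z < y + e -> h y <= h z) ->
  exists p q, 0 <= p < q /\ q <= 1 /\
    forall y z : I, p <= y -> y < z -> z < q -> h y < h z.
Proof.
  intros inj loc; apply NNPP; intros no.
  (* Failure of the conclusion puts a descent of [h] in every interval. *)
  assert (desc : forall p q, 0 <= p < q -> q <= 1 ->
            exists a b : I, p <= a /\ a < b /\ b < q /\ h b < h a).
  { intros p q hp hq; apply NNPP; intros no'; apply no; exists p, q.
    split; [assumption|]; split; [assumption|]; intros y z h1 h2 h3.
    destruct (val_neq (h y) (h z)) as [|lt]; [|assumption|].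
    - intros e; apply inj in e; subst; lra.
    - destruct no'; exists y, z; auto. }
  set (St := {pq : R * R | 0 <= fst pq < snd pq /\ snd pq <= 1}).
  (* For a descent a < b of length below 1/(n+1), [h] is at least [h a], hence above [h b], just
     right of a. So every y in a short closed interval starting at a has the lower value [h b]
     within 1/(n+1) to its right. *)
  assert (step : forall (ns : nat * St), exists s' : St,
     let (p, q) := proj1_sig (snd ns) in let (p', q') := proj1_sig s' in
     p <= p' /\ q' < q /\ forall y : I, p' <= y <= q' ->
       exists z : I, y < z < y + / INR (S (fst ns)) /\ h z < h y).
  { intros [n [[p q] [hp hq]]]; simpl fst in *; simpl snd in *; simpl proj1_sig.
    assert (hn : 0 < / INR (S n)) by (apply Rinv_0_lt_compat, lt_0_INR; lia).
    destruct (Rmin_pos (q - p) (/ INR (S n))) as [d [hd [l1 l2]]]; try lra.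
    destruct (desc p (p + d)) as [a [b [h1 [h2 [h3 h4]]]]]; try lra.
    destruct (loc a) as [e [he H]].
    destruct (Rmin_pos (e / 2) ((b - a) / 2)) as [e' [he' [k1 k2]]]; try lra.
    assert (ok : 0 <= fst (val a, a + e') < snd (val a, a + e') /\ snd (val a, a + e') <= 1)
      by (simpl; ilra).
    exists (exist _ (val a, a + e') ok); simpl proj1_sig; cbv iota beta; split; [lra|]; split; [lra|].
    intros y hy; exists b; split; [lra|].
    assert (k := H y ltac:(lra)); lra. }
  destruct (choice _ step) as [nxt Hn].
  assert (ok0 : 0 <= fst (0, 1) < snd (0, 1) /\ snd (0, 1) <= 1) by (simpl; lra).
  set (seq := fix seq n : St := match n with
              | O => exist _ (0, 1) ok0 | S m => nxt (m, seq m) end).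
  set (p := fun n => fst (proj1_sig (seq n))).
  set (q := fun n => snd (proj1_sig (seq n))).
  assert (pq : forall n, 0 <= p n < q n /\ q n <= 1) by (intros n; apply (proj2_sig (seq n))).
  assert (Hs : forall n, p n <= p (S n) /\ q (S n) < q n /\
     forall y : I, p (S n) <= y <= q (S n) ->
       exists z : I, y < z < y + / INR (S n) /\ h z < h y).
  { intros n; assert (k := Hn (n, seq n)); unfold p, q.
    change (seq (S n)) with (nxt (n, seq n)); simpl snd in k; simpl fst in k.
    destruct (proj1_sig (seq n)), (proj1_sig (nxt (n, seq n))); exact k. }
  assert (pm : forall n m, p n <= p (n + m)%nat).
  { intros n; induction m as [|m IH]; [rewrite Nat.add_0_r; lra|].
    rewrite Nat.add_succ_r; destruct (Hs (n + m)%nat); lra. }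
  assert (qm : forall n m, q (n + m)%nat <= q n).
  { intros n; induction m as [|m IH]; [rewrite Nat.add_0_r; lra|].
    rewrite Nat.add_succ_r; destruct (Hs (n + m)%nat) as [_ []]; lra. }
  assert (cross : forall n m, p n <= q m).
  { intros n m; assert (k1 := pm n m); assert (k2 := qm m n); rewrite Nat.add_comm in k2.
    assert (k3 := pq (n + m)%nat); lra. }
  destruct (completeness (fun t => exists n, t = p n)) as [s [ub lub]].
  - exists 1; intros t [n ->]; assert (k := pq n); lra.
  - exists (p 0%nat), 0%nat; reflexivity.
  - assert (sp : forall n, p n <= s) by (intros n; apply ub; exists n; reflexivity).
    assert (sq : forall n, s <= q n) by (intros n; apply lub; intros t [m ->]; apply cross).
    (* Strict decrease of the right ends keeps the limit point below 1, hence on the circle.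
       Descents arbitrarily close to its right then contradict [loc]. *)
    assert (s01 : 0 <= s < 1).
    { split; [apply Rle_trans with (p 0%nat); [apply pq|apply sp]|].
      destruct (Hs 0%nat) as [_ [k _]]; assert (k' := sq 1%nat); assert (k2 := pq 0%nat); lra. }
    destruct (loc (toI s)) as [e [he H]].
    destruct (archimed_cor1 e he) as [n [hn n0]]; destruct n as [|n]; [lia|].
    destruct (Hs n) as [_ [_ K]]; destruct (K (toI s)) as [z [hz lz]].
    + rewrite val_toI by assumption; split; auto.
    + assert (k := H z ltac:(lra)); lra.
Qed.

Lemma IET_normaliser (g h : I -> I) :
  (forall x, h (g x) = x) -> (forall y, g (h y) = y) ->
  (forall B, elementary B -> elementary (fun x => B (g x))) ->
  (forall B, elementary B -> elementary (fun y => B (h y))) ->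
  (forall f, is_IET f -> is_IET (compI g (compI f h))) -> is_IET g.
Proof.
  intros hg gh eg eh nm.
  (* The pushforward of the measure by [h] is again invariant because [g] normalises the group; by
     uniqueness [g] preserves the measure of intervals. *)
  assert (meas : forall a b, 0 <= a <= b -> b <= 1 ->
            lebesgue (fun y => a <= h y < b) = b - a).
  { apply (lebesgue_unique (fun B => lebesgue (fun y => B (h y)))).
    - intros B C e; apply lebesgue_ext; intros y; apply e.
    - intros B hB; apply lebesgue_ge0, eh, hB.
    - intros B C hB hC D; apply (lebesgue_add (fun y => B (h y)) (fun y => C (h y))); auto.
    - rewrite (lebesgue_ext _ (fun x => 0 <= x < 1)), lebesgue_interval; try lra.
      intros x; assert (r := val_range x); tauto.
    - intros f B hf hB; rewrite <- (lebesgue_invariant _ (fun y => B (h y)) (nm f hf)); auto.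
      apply lebesgue_ext; intros y; unfold compI; rewrite hg; tauto. }
  destruct (increasing_somewhere h) as [p [q [hp [hq inc]]]].
  { intros x y e; rewrite <- (gh x), e; apply gh. }
  { intros y.
    (* The points z with h y <= h z form an elementary set containing y, hence containing a right
       neighbourhood of y. *)
    destruct (proj1 (eh _ (elementary_interval (h y) 1)) y) as [e [he H]].
    exists e; split; [assumption|]; intros z hz; apply (H z hz).
    assert (r := val_range (h y)); lra. }
  set (s := h (toI p)).
  destruct (proj1 (eg _ (elementary_interval p q)) s) as [e [he H]].
  assert (gs : val (g s) = p) by (unfold s; rewrite gh, val_toI; lra).
  assert (K : forall u : I, s <= u < s + e -> p <= g u < q).
  { intros u hu; apply H; [assumption|lra]. }
  assert (ginc : forall u v : I, s <= u < s + e -> s <= v < s + e -> u < v -> g u < g v).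
  { intros u v hu hv lt; destruct (val_neq (g u) (g v)) as [|lt']; [|assumption|].
    - intros e'; apply (f_equal h) in e'; rewrite !hg in e'; rewrite e' in lt; lra.
    - assert (k := inc (g v) (g u)); rewrite !hg in k.
      assert (k1 := K u hu); assert (k2 := K v hv); lra. }
  (* Monotonicity of [g] and [h] identifies the image of [s,u) under [g] with [g s, g u); comparing
     measures gives the translation. *)
  assert (trans : forall u : I, s <= u < s + e -> val (g u) = g s + (u - s)).
  { intros u hu; destruct (Req_dec s u) as [e'|ne].
    - apply val_inj in e'; rewrite <- e'; lra.
    - assert (gsu := ginc s u ltac:(lra) hu ltac:(lra)).
      assert (m := meas s u ltac:(ilra) ltac:(ilra)).
      rewrite (lebesgue_ext _ (fun y => g s <= y < g u)), lebesgue_interval in m;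
        try ilra.
      intros y; split; intros r.
      + assert (hy := K (h y) ltac:(lra)); rewrite gh in hy.
        split.
        * rewrite gs; apply hy.
        * rewrite <- (gh y); apply ginc; try lra; ilra.
      + assert (ku := K u hu); split.
        * destruct (Req_dec (g s) y) as [e'|ne'].
          -- apply val_inj in e'; rewrite <- e', hg; lra.
          -- assert (k := inc (g s) y ltac:(lra) ltac:(lra) ltac:(lra)).
             rewrite hg in k; lra.
        * assert (k := inc y (g u) ltac:(lra) ltac:(lra) ltac:(lra)).
          rewrite hg in k; lra. }
  (* Rotations are transitive, so one interval on which g is a translation suffices. *)
  set (k := fun c => compI (compI g (compI (rotation (- c)) h))
                       (compI (rotation (g s - s)) (rotation c))).
  assert (Lk : forall c, local_translation (k c)).
  { intros c; apply local_translation_comp.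
    - apply IET_local_translation, nm, IET_rotation.
    - apply local_translation_comp; apply local_translation_rotation. }
  assert (gk : forall c x, s <= rotation c x < s + e -> g x = k c x).
  { intros c x r; unfold k, compI.
    replace (rotation (g s - s) (rotation c x)) with (g (rotation c x)).
    - rewrite hg, rotation_add, Rplus_opp_r, rotation_0; reflexivity.
    - apply val_inj; assert (t := trans _ r); rewrite rotation_small; ilra. }
  apply IET_intro.
  - intros x y e'; rewrite <- (hg x), e'; apply hg.
  - intros y; exists (h y); apply gh.
  - split.
    + intros x; destruct (proj1 (local_translation_rotation (s - x)) x) as [d1 [hd1 R1]].
      destruct (proj1 (Lk (s - x)) x) as [d2 [hd2 R2]].
      rewrite rotation_transitive in R1.
      destruct (Rmin_pos d1 d2) as [d3 [hd3 [l1 l2]]]; try lra.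
      destruct (Rmin_pos d3 e) as [d [hd [l3 l4]]]; try lra.
      exists d; split; [assumption|]; intros y hy.
      rewrite (gk (s - x) y), (gk (s - x) x).
      * apply R2; lra.
      * rewrite rotation_transitive; lra.
      * rewrite (R1 y); lra.
    (* The shift s + e1 - t sends points of [t - e1, t) into [s, s + e1), where [g] is known. *)
    + intros t ht; destruct (Rmin_pos e (1 - s)) as [e1 [he1 [l1 l2]]]; try ilra.
      destruct (proj2 (Lk (s + e1 - t)) t ht) as [d1 [c [hd1 R1]]].
      destruct (Rmin_pos d1 e1) as [d [hd [l3 l4]]]; try lra.
      exists d, c; split; [assumption|]; intros y hy.
      rewrite (gk (s + e1 - t) y); [apply R1; lra|].
      rewrite rotation_small; ilra.
Qed.

(** * Images of germs of points *)

Lemma separate (x y : I) : x <> y -> exists B, elementary B /\ B x /\ ~ B y.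
Proof.
  intros ne; destruct (val_neq x y ne).
  - exists (fun z => x <= z < y); split; [apply elementary_interval|]; lra.
  - exists (fun z => x <= z < 1); split; [apply elementary_interval|]; ilra.
Qed.

(** The Boolean automorphism sends the right germ of x to that of y. Belonging to the ultrafilter of
    a right germ is plain membership of the point, as elementary sets are constant just to its
    right. *)
Definition right_germ_pair (phi : (I -> I) -> I -> I) (x y : I) : Prop :=
  forall B, elementary B -> (B x <-> induced phi B y).

(* The ultrafilter of the B with y in induced phi B is that of a right germ or
   of a left germ. *)
Lemma germ_dichotomy phi y : is_aut phi -> (exists x, right_germ_pair phi x y) \/
  exists t, 0 < t <= 1 /\ forall u, u < t -> induced phi (fun x => u <= x < t) y.
Proof.
  intros a.
  assert (iv := elementary_interval).
  assert (emp : forall v, v <= 0 -> ~ induced phi (fun x => 0 <= x < v) y).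
  { intros v hv i.
    apply (proj2 (induced_disjoint phi (fun x : I => 0 <= x < v) _ a (iv 0 v) (iv 0 v))) with y;
      auto; intros x; lra. }
  assert (full : induced phi (fun x => 0 <= x < 1) y).
  { destruct (induced_cover phi _ _ _ y a (iv 0 1) (iv 0 1) (iv 0 1)) as [|[|]]; auto.
    intros x; left; apply val_range. }
  (* The supremum t locates the ultrafilter: it is the left germ of t if it contains [0,t), and the
     right germ of t otherwise. *)
  destruct (completeness (fun v => 0 <= v <= 1 /\ ~ induced phi (fun x => 0 <= x < v) y))
    as [t [ub lub]].
  - exists 1; intros v [hv _]; lra.
  - exists 0; split; [lra|apply emp; lra].
  - assert (t0 : 0 <= t) by (apply ub; split; [lra|apply emp; lra]).
    assert (t1 : t <= 1) by (apply lub; intros v [hv _]; lra).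
    assert (below : forall u, u < t -> ~ induced phi (fun x => 0 <= x < u) y).
    { intros u hu i; assert (t <= u); [|lra]; apply lub; intros v [hv n].
      destruct (Rle_or_lt v u) as [|lt]; [assumption|]; destruct n.
      revert i; apply induced_mono; auto; intros x; lra. }
    assert (above : forall v, t < v <= 1 -> induced phi (fun x => 0 <= x < v) y).
    { intros v hv; apply NNPP; intros n; assert (v <= t); [|lra]; apply ub; split; [lra|auto]. }
    assert (diff : forall u v, induced phi (fun x => 0 <= x < v) y ->
              ~ induced phi (fun x => 0 <= x < u) y -> induced phi (fun x => u <= x < v) y).
    { intros u v i n; assert (k := induced_diff phi _ _ y a (iv 0 v) (iv 0 u) i n).
      revert k; apply induced_mono; auto using elementary_and, elementary_not.
      intros x; lra. }
    destruct (classic (induced phi (fun x => 0 <= x < t) y)) as [i|n].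
    + right; exists t; split.
      * split; [|assumption]; apply Rnot_le_lt; intros le; apply (emp t le i).
      * intros u hu; apply diff; auto.
    + left; assert (tlt : t < 1).
      { apply Rnot_le_lt; intros le; apply n; replace t with 1 by lra; exact full. }
      exists (toI t).
      assert (imp : forall B, elementary B -> B (toI t) -> induced phi B y).
      { intros B hB b; destruct (proj1 hB (toI t)) as [e [he H]].
        rewrite val_toI in H by lra.
        destruct (Rmin_pos e (1 - t)) as [d [hd [l1 l2]]]; try lra.
        apply (induced_mono phi (fun x => t <= x < t + d)); auto.
        - intros x hx; apply H; [lra|assumption].
        - apply diff; auto; apply above; lra. }
      intros B hB; split; [apply imp, hB|]; intros i; apply NNPP; intros nb.
      apply (imp _ (elementary_not B hB)), induced_not in nb; auto.
Qed.

(** The pair ([f], [phi f]) moves germ pairs to germ pairs. Rotations reach every x from one pair,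
    and preimages of rotations under [phi] reach every y; separation of points makes the pairing a
    bijection. *)
Lemma inner_of_right_germ_pair phi x0 y0 : is_aut phi -> right_germ_pair phi x0 y0 ->
  is_inner phi.
Proof.
  intros a pr0.
  assert (move : forall f x y, is_IET f -> right_germ_pair phi x y ->
            right_germ_pair phi (f x) (phi f y)).
  { intros f x y hf pr B hB; rewrite <- induced_preim by assumption.
    apply (pr (fun z => B (f z))), elementary_preim; auto using IET_local_translation. }
  assert (exy : forall x, exists y, right_germ_pair phi x y).
  { intros x; rewrite <- (rotation_transitive x0 x); eexists.
    apply move, pr0; apply IET_rotation. }
  assert (eyx : forall y, exists x, right_germ_pair phi x y).
  { intros y; destruct (aut_surj phi _ a (IET_rotation (y - y0))) as [f [hf e]].
    exists (f x0); assert (k := move f x0 y0 hf pr0); rewrite e, rotation_transitive in k.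
    exact k. }
  destruct (choice _ exy) as [g G]; destruct (choice _ eyx) as [h H].
  assert (uy : forall x y y', right_germ_pair phi x y -> right_germ_pair phi x y' -> y = y').
  { intros x y y' p p'; apply NNPP; intros ne; destruct (separate y y' ne) as [D [hD [d nd]]].
    destruct (induced_surj phi D a hD) as [B [hB E]].
    apply nd, E, p', p, E, d; assumption. }
  assert (ux : forall x x' y, right_germ_pair phi x y -> right_germ_pair phi x' y -> x = x').
  { intros x x' y p p'; apply NNPP; intros ne; destruct (separate x x' ne) as [B [hB [d nd]]].
    apply nd, p', p, d; assumption. }
  assert (conj : forall f x, is_IET f -> phi f (g x) = g (f x)).
  { intros f x hf; apply (uy (f x)); auto. }
  exists g; split; [|intros f hf; apply functional_extensionality; intros x; apply conj, hf].
  apply (IET_normaliser g h).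
  - intros x; apply (ux _ _ (g x)); auto.
  - intros y; apply (uy (h y)); auto.
  - intros D hD; destruct (induced_surj phi D a hD) as [B [hB E]].
    apply (elementary_ext B); [|assumption]; intros x; rewrite <- E; apply G, hB.
  - intros B hB; apply (elementary_ext (induced phi B)); [|apply induced_elementary; auto].
    intros y; symmetry; apply H, hB.
  - intros f hf; replace (compI g (compI f h)) with (phi f); [apply aut_IET; auto|].
    apply functional_extensionality; intros y; apply (uy (f (h y))); auto.
Qed.

(** * The automorphism [Psi_T] *)

Lemma interval_avoid (l : list I) a b : 0 <= a < b -> b <= 1 ->
  exists z : I, a < z < b /\ ~ In z l.
Proof.
  revert a b; induction l as [|w l IH]; intros a b ha hb.
  - exists (toI ((a + b) / 2)); rewrite val_toI by lra; split; [lra|auto].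
  - destruct (Rlt_or_le w ((a + b) / 2)).
    + destruct (IH ((a + b) / 2) b) as [z [hz n]]; try lra.
      exists z; split; [lra|]; intros [e|i]; [subst; lra|auto].
    + destruct (IH a ((a + b) / 2)) as [z [hz n]]; try lra.
      exists z; split; [lra|]; intros [e|i]; [subst; lra|auto].
Qed.

(** Every right neighbourhood of x contains a point of agreement, and the value there determines the
    value at x. *)
Lemma cofinite_eq_local_translation f g : local_translation f -> local_translation g ->
  cofinite_eq f g -> f = g.
Proof.
  intros [fr _] [gr _] [l H]; apply functional_extensionality; intros x; apply val_inj.
  destruct (fr x) as [e1 [he1 H1]], (gr x) as [e2 [he2 H2]].
  destruct (Rmin_pos e1 e2) as [e3 [he3 [l1 l2]]]; try lra.
  destruct (Rmin_pos e3 (1 - x)) as [e [he [l3 l4]]]; try ilra.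
  destruct (interval_avoid l x (x + e)) as [z [hz n]]; try ilra.
  assert (k := f_equal val (H z n)); rewrite (H1 z), (H2 z) in k by lra; lra.
Qed.

Lemma T_val (x : I) : 0 < x -> val (T x) = 1 - x.
Proof. intros hx; apply (frac_part_eq (-1)); [unfold val; lra|ilra]. Qed.

Lemma T_0 (x : I) : val x = 0 -> T x = x.
Proof.
  intros e; unfold T; change (proj1_sig x) with (val x); rewrite e, Ropp_0, <- e; apply toI_val.
Qed.

Lemma T_T (x : I) : T (T x) = x.
Proof.
  destruct (Req_dec x 0) as [e|ne]; [rewrite !T_0; auto; rewrite T_0; auto|].
  apply val_inj; assert (k := T_val x ltac:(ilra)); rewrite T_val; ilra.
Qed.

(** If [f] is y + c just left of 1 - x, then its conjugate by [T] is x - c just right of x. This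
    value is taken at every x, exceptional points included, which makes the flip
    right-continuous. *)
Lemma flip_exists f : local_translation f ->
  exists h, local_translation h /\ cofinite_eq h (compI T (compI f T)).
Proof.
  intros Lf.
  destruct (choice (fun (x : I) c => exists e, 0 < e <= 1 - x /\ 0 < 1 - x + c <= 1 /\
     forall y : I, 1 - x - e <= y < 1 - x -> val (f y) = y + c)) as [c C].
  { intros x; destruct (left_germ f (1 - x) Lf) as [e [c H]]; [ilra|]; exists c, e; exact H. }
  exists (fun x : I => toI (x - c x)).
  assert (V : forall u v d, 0 <= u < v -> v <= 1 ->
    (forall y : I, u <= y < v -> val (f y) = y + d) ->
    forall x : I, 1 - v <= x < 1 - u -> val (toI (x - c x)) = x - d).
  { intros u v d hu hv H x hx; destruct (C x) as [e [he [r K]]].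
    rewrite val_toI by lra.
    destruct (Rmin_pos e (1 - u - x)) as [e' [he' [l1 l2]]]; try lra.
    assert (z : val (toI (1 - x - e')) = 1 - x - e') by (apply val_toI; ilra).
    assert (k1 := K (toI (1 - x - e')) ltac:(lra)).
    assert (k2 := H (toI (1 - x - e')) ltac:(lra)); lra. }
  split; [split|].
  - intros x; destruct (left_germ f (1 - x) Lf) as [e [d [he [_ H]]]]; [ilra|].
    exists e; split; [lra|]; intros y hy.
    assert (W := V (1 - x - e) (1 - x) d ltac:(lra) ltac:(ilra) H).
    rewrite (W y), (W x); lra.
  - intros t ht; destruct (proj1 Lf (toI (1 - t))) as [e [he H]].
    rewrite val_toI in H by lra.
    destruct (Rmin_pos e t) as [e' [he' [l1 l2]]]; try lra.
    exists e', (- (f (toI (1 - t)) - (1 - t))); split; [lra|]; intros y hy.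
    rewrite (V (1 - t) (1 - t + e') (f (toI (1 - t)) - (1 - t))); try lra.
    intros z hz; rewrite (H z); lra.
  - cut (exists l, forall x : I, 1 - 1 <= x < 1 - 0 -> ~ In x l ->
           toI (x - c x) = T (f (T x))).
    { intros [l H]; exists l; intros x n; apply H; [ilra|exact n]. }
    apply (translation_chain f (fun u v => exists l, forall x : I, 1 - v <= x < 1 - u ->
             ~ In x l -> toI (x - c x) = T (f (T x))) Lf).
    + intros u v w hu hv [l1 H1] [l2 H2]; exists (l1 ++ l2); intros x hx n.
      rewrite in_app_iff in n.
      destruct (Rle_or_lt (1 - v) x); [apply H1|apply H2]; try lra; tauto.
    (* The left end 1 - v of a flipped piece is excluded: its reflection is v modulo 1, outside
       [u,v) or, when v = 1, possibly in another piece. *)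
    + intros u v d hu hv H; exists (toI (1 - v) :: nil); intros x hx n.
      assert (nx : 1 - v < x).
      { destruct (Req_dec (1 - v) x) as [e|]; [|lra].
        destruct n; left; apply val_inj; rewrite val_toI; lra. }
      destruct (translation_range f u v d hu hv H) as [r1 r2].
      assert (k := T_val x ltac:(lra)).
      assert (k' := H (T x) ltac:(lra)).
      apply val_inj; rewrite (V u v d hu hv H x hx), T_val; lra.
Qed.

Lemma cofinite_eq_flip_comp a b f g : is_IET g ->
  cofinite_eq a (compI T (compI f T)) -> cofinite_eq b (compI T (compI g T)) ->
  cofinite_eq (compI a b) (compI T (compI (compI f g) T)).
Proof.
  intros hg [la Ha] [lb Hb]; destruct (IET_inverse g hg) as [k [_ [kg _]]].
  exists (lb ++ map (fun z => T (k (T z))) la); intros x n.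
  rewrite in_app_iff in n; unfold compI in *; rewrite Hb by tauto.
  rewrite Ha, T_T; [reflexivity|]; intros i; apply n; right.
  apply in_map_iff; exists (T (g (T x))); split; [|assumption].
  rewrite T_T, kg, T_T; reflexivity.
Qed.

(** The choice operator needs a witness, and bijectivity is the issue: the flips of [f] and of its
    inverse compose to the identity off finitely many points, hence everywhere. *)
Lemma Psi_T_spec f : is_IET f ->
  is_IET (Psi_T f) /\ cofinite_eq (Psi_T f) (compI T (compI f T)).
Proof.
  intros hf; apply (epsilon_spec (inhabits idI)
    (fun h => is_IET h /\ cofinite_eq h (compI T (compI f T)))).
  destruct (IET_inverse f hf) as [k [hk [kf fk]]].
  destruct (flip_exists f) as [a [La Ha]]; [auto using IET_local_translation|].
  destruct (flip_exists k) as [b [Lb Hb]]; [auto using IET_local_translation|].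
  assert (one : forall p q a b, (forall x, p (q x) = x) ->
     local_translation a -> local_translation b ->
     cofinite_eq (compI a b) (compI T (compI (compI p q) T)) -> forall x, a (b x) = x).
  { intros p q a' b' pq La' Lb' [l H] x.
    assert (e : compI a' b' = idI); [|exact (f_equal (fun r => r x) e)].
    apply cofinite_eq_local_translation; auto using local_translation_comp, local_translation_id.
    exists l; intros z n; rewrite H by assumption.
    unfold compI; rewrite pq; apply T_T. }
  exists a; split; [|assumption]; apply (IET_cancel a b La).
  - apply (one k f); auto using cofinite_eq_flip_comp.
  - apply (one f k); auto using cofinite_eq_flip_comp.
Qed.

Lemma Psi_T_unique f h : is_IET f -> is_IET h ->
  cofinite_eq h (compI T (compI f T)) -> Psi_T f = h.
Proof.
  intros hf hh [l H]; destruct (Psi_T_spec f hf) as [hp [l' H']].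
  apply cofinite_eq_local_translation; auto using IET_local_translation.
  exists (l ++ l'); intros x n; rewrite in_app_iff in n; rewrite H, H'; tauto.
Qed.

Lemma Psi_T_IET f : is_IET f -> is_IET (Psi_T f).
Proof. apply Psi_T_spec. Qed.

Lemma Psi_T_involutive f : is_IET f -> Psi_T (Psi_T f) = f.
Proof.
  intros hf; apply Psi_T_unique; auto using Psi_T_IET.
  destruct (Psi_T_spec f hf) as [_ [l H]]; exists (map T l); intros x n.
  unfold compI in *; rewrite H, !T_T; [reflexivity|].
  intros i; apply n, in_map_iff; exists (T x); split; [apply T_T|assumption].
Qed.

Lemma Psi_T_aut : is_aut Psi_T.
Proof.
  split; [exact Psi_T_IET|]; split; [|split].
  - intros f g hf hg; apply Psi_T_unique; auto using IET_comp, Psi_T_IET.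
    apply cofinite_eq_flip_comp; auto; apply Psi_T_spec; assumption.
  - intros f g hf hg e; rewrite <- (Psi_T_involutive f hf), e; apply Psi_T_involutive, hg.
  - intros h hh; exists (Psi_T h); auto using Psi_T_IET, Psi_T_involutive.
Qed.

Lemma T_rotation c x : T (rotation c (T x)) = rotation (- c) x.
Proof.
  unfold T at 2, rotation; change (proj1_sig x) with (val x).
  destruct (frac_part_split (- x)) as [k e].
  assert (e1 : toI (val (toI (- x)) + c) = toI (- x + c)).
  { apply (toI_shift (- k)); rewrite opp_IZR.
    change (val (toI (- x))) with (frac_part (- x)); lra. }
  rewrite e1; unfold T; destruct (frac_part_split (- x + c)) as [m e2].
  apply (toI_shift m); change (proj1_sig (toI (- x + c))) with (frac_part (- x + c)); lra.
Qed.

Lemma Psi_T_rotation c : Psi_T (rotation c) = rotation (- c).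
Proof.
  apply Psi_T_unique; try apply IET_rotation.
  exists nil; intros x _; symmetry; apply T_rotation.
Qed.

(* An intertwiner g would satisfy g(x + c) = g x - c, against g(x + c) = g x + c. *)
Lemma Psi_T_not_inner : ~ is_inner Psi_T.
Proof.
  intros [g [hg H]]; set (o := toI 0).
  assert (o0 : val o = 0) by (apply val_toI; lra).
  destruct (proj1 (IET_local_translation g hg) o) as [e [he K]].
  destruct (Rmin_pos e (1 - g o)) as [d [hd [l1 l2]]]; try ilra.
  (* Equality of g o + c and g o - c modulo 1 would make 2c an integer; 0 < c <= 1/4 forbids it. *)
  destruct (Rmin_pos (d / 2) (/ 4)) as [c [hc [l3 l4]]]; try lra.
  assert (eq := f_equal (fun k => k o) (H (rotation c) (IET_rotation c))).
  unfold compI in eq; simpl in eq; rewrite Psi_T_rotation in eq.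
  assert (rc : val (rotation c o) = c) by (rewrite rotation_small; lra).
  apply (f_equal val) in eq; rewrite (K (rotation c o)), rc, o0 in eq by lra.
  destruct (Rle_or_lt c (g o)).
  - rewrite rotation_small in eq; ilra.
  - rewrite (rotation_val (- c) _ (-1)) in eq; ilra.
Qed.

(** * Classification of the automorphisms and triviality of the centre *)

Lemma aut_compose phi psi : is_aut phi -> is_aut psi -> is_aut (fun f => phi (psi f)).
Proof.
  intros a b; split; [|split; [|split]].
  - intros f hf; apply aut_IET, aut_IET; assumption.
  - intros f g hf hg; rewrite !aut_comp; auto using aut_IET.
  - intros f g hf hg e; apply (aut_inj psi), (aut_inj phi); auto using aut_IET.
  - intros h hh; destruct (aut_surj phi h a hh) as [k [hk <-]].
    destruct (aut_surj psi k b hk) as [f [hf <-]]; exists f; auto.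
Qed.

(** Reflection exchanges the left germ of t with the right germ of 1 - t. The support of [Psi_T s]
    is constant just left of t, so it can be read off at a point [z] where [Psi_T s] equals the
    actual conjugate. *)
Lemma right_germ_pair_flip phi t y : is_aut phi -> 0 < t <= 1 ->
  (forall u, u < t -> induced phi (fun x => u <= x < t) y) ->
  right_germ_pair (fun f => phi (Psi_T f)) (toI (1 - t)) y.
Proof.
  intros a ht L B hB; destruct (involution_moving B hB) as [s [hs S]].
  assert (hPs : involution (Psi_T s)).
  { apply aut_involution; auto using Psi_T_aut; apply hs. }
  rewrite (inducedE (fun f => phi (Psi_T f)) s); auto using aut_compose, Psi_T_aut.
  set (C := fun x => Psi_T s x <> x).
  rewrite <- (inducedE phi (Psi_T s) C) by (auto; intros; unfold C; tauto).
  assert (hC : elementary C) by (apply elementary_moved, involution_local_translation, hPs).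
  assert (germ : exists u, u < t /\ forall x : I, u <= x < t -> (C x <-> B (toI (1 - t)))).
  { destruct (proj1 hB (toI (1 - t))) as [e1 [he1 H1]]; rewrite val_toI in H1 by lra.
    destruct (proj2 hC t ht) as [e2 [he2 H2]].
    destruct (Rmin_pos e1 e2) as [e3 [he3 [l1 l2]]]; try lra.
    destruct (Rmin_pos e3 t) as [e [he [l3 l4]]]; try lra.
    exists (t - e); split; [lra|]; intros x hx.
    destruct (Psi_T_spec s (proj1 hs)) as [_ [l Hl]].
    destruct (interval_avoid l (t - e) t) as [z [hz n]]; try lra.
    rewrite (H2 x z) by lra; assert (k := T_val z ltac:(lra)).
    rewrite <- (H1 (T z)) by lra; unfold C; rewrite Hl by assumption; unfold compI.
    rewrite <- S; split; intros ne e'; apply ne.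
    - rewrite e'; apply T_T.
    - rewrite <- e' at 2; rewrite T_T; reflexivity. }
  destruct germ as [u [hu G]]; assert (i := L u hu).
  destruct (classic (B (toI (1 - t)))) as [b|b]; split; intros h; try tauto.
  - revert i; apply induced_mono; auto using elementary_interval.
    intros x hx; apply G; assumption.
  - exfalso; revert h; apply induced_not; auto.
    revert i; apply induced_mono; auto using elementary_interval, elementary_not.
    intros x hx; rewrite G; assumption.
Qed.

Lemma aut_inner_or_flip phi : is_aut phi -> is_inner phi \/
  exists g, is_IET g /\ forall f, is_IET f -> compI (phi f) g = compI g (Psi_T f).
Proof.
  intros a; destruct (germ_dichotomy phi (toI 0) a) as [[x pr]|[t [ht L]]].
  - left; apply (inner_of_right_germ_pair phi x (toI 0)); assumption.
  - right; destruct (inner_of_right_germ_pair _ _ _ (aut_compose _ _ a Psi_T_aut)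
      (right_germ_pair_flip phi t (toI 0) a ht L)) as [g [hg H]].
    exists g; split; [assumption|]; intros f hf.
    rewrite <- H, Psi_T_involutive by auto using Psi_T_IET; reflexivity.
Qed.

(** A central [g] preserves the support of every involution, yet some support contains x and not
    [g x]. *)
Lemma IET_center_trivial g : is_IET g ->
  (forall f, is_IET f -> compI f g = compI g f) -> g = idI.
Proof.
  intros hg H; apply functional_extensionality; intros x; apply NNPP; intros ne.
  destruct (separate x (g x)) as [B [hB [b nb]]]; [intros e; apply ne; symmetry; exact e|].
  destruct (involution_moving B hB) as [s [hs S]].
  apply S in b; apply nb, S; intros e; apply b, (IET_inj g hg).
  transitivity (s (g x)); [|exact e].
  symmetry; exact (f_equal (fun k => k x) (H s (proj1 hs))).
Qed.

(** Aut(E) = Inn(E) ⋊ <Psi_T> ≅ E ⋊ Z/2Z. *)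
Theorem theorem1p6 :
  (* Psi_T is an automorphism of E *)
  is_aut Psi_T /\
  (* of order dividing 2 on E *)
  (forall f, is_IET f -> Psi_T (Psi_T f) = f) /\
  (* Inn(E) ∩ <Psi_T> = 1, i.e. Psi_T is not inner (so <Psi_T> ≅ Z/2Z) *)
  ~ is_inner Psi_T /\
  (* Aut(E) = Inn(E) <Psi_T> *)
  (forall phi, is_aut phi ->
     is_inner phi \/
     exists g, is_IET g /\
       forall f, is_IET f -> compI (phi f) g = compI g (Psi_T f)) /\
  (* E has trivial center, so Inn(E) ≅ E *)
  (forall g, is_IET g -> (forall f, is_IET f -> compI f g = compI g f) -> g = idI).
Proof.
  split; [exact Psi_T_aut|]; split; [|split; [|split]].
  - exact Psi_T_involutive.
  - exact Psi_T_not_inner.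
  - exact aut_inner_or_flip.
  - exact IET_center_trivial.
Qed.
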